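(* Let $p$ be an odd prime and let $f\colon S_1\to M_p$ be the normalized $p$-adic character map of the $p$-adic Heisenberg VOA. Let $u_1'=\lim_{a\to\infty}u_{1+p^a(p-1)}\in S_1$, where the states $u_r$ are as defined in the context (this limit exists). Then $$f(u'_1)=\lim_{a\to\infty}(1-p^{1+p^a(p-1)})\,2G_{2+p^a(p-1)}=2G_2^*,$$ where $$G_2^*=\frac{p^2-1}{24}+\sum_{n\ge1}\sigma^*(n)q^n$$ and $\sigma^*(n)$ is the sum of the divisors of $n$ that are coprime to $p$. In particular the image of $f$ contains the $p$-stabilized Eisenstein series $G_2^*$ of weight $2$.
   Context: $S=\mathbf{Q}_p[h_{-1},h_{-2},\ldots]$ is the rank one Heisenberg VOA: for $n<0$, $h(n)=h_n$ acts by multiplication; for $n>0$, $h(n)=h_n$ acts as $n\,\partial/\partial h_{-n}$; $h(0)=0$; it has its usual VOA structure with vacuum $\mathbf{1}=1$, $h=h_{-1}$, $Y(h,z)=\sum_nh(n)z^{-n-1}$, conformal vector $\tfrac12h_{-1}^2$, central charge $1$, and $\prod_ih_{-n_i}$ has weight $\sum_in_i$. $S^{(n)}$ is the weight $n$ subspace. $S_1$ is the completion of $S$ for the sup-norm of the $p$-adic absolute values of coefficients of polynomials in the $h_{-n}$. For $v\in S$ homogeneous of weight $k$, $o(v)=v(k-1)$ (extended linearly), where $Y(v,z)=\sum_nv(n)z^{-n-1}$, and $Z(v,q)=q^{-1/24}\sum_{n\ge0}\mathrm{Tr}_{S^{(n)}}(o(v))q^n$. With $\eta=q^{1/24}\prod_{n\ge1}(1-q^n)$,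 the map $f\colon S_1\to M_p$ is the continuous $\mathbf{Q}_p$-linear extension of $v\mapsto\eta\cdot Z(v,q)$, where $M_p$ is Serre's ring of $p$-adic modular forms, the completion of $\mathbf{Q}_p[E_4,E_6]$ with respect to the $p$-adic sup-norm on $q$-expansions ($E_4,E_6$ being the normalized Eisenstein series of level one and weights $4,6$). For a positive odd integer $r$, $$u_r=(1-p^r)\left(\sum_{m=0}^\infty c(r,m)h(-m-1)h(-1)\mathbf{1}-\frac{B_{r+1}}{r+1}\mathbf{1}\right),\qquad c(r,m)=\sum_{j=0}^m(-1)^{m+j}\binom{m}{j}(j+1)^{r-1},$$ where $c(r,m)=0$ for $m\ge r$, so the sum is finite, and the Bernoulli numbers are defined by $\frac{z}{e^z-1}=\sum_{k\ge0}\frac{B_k}{k!}z^k$. For even $k\ge 2$, $G_k=-\frac{B_k}{2k}+\sum_{n\ge1}\sigma_{k-1}(n)q^n$ is the weight $k$ Eisenstein series, where $\sigma_{k-1}(n)=\sum_{d\mid n}d^{k-1}$.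
   Formalization: The constant term of G_2^* is corrected from (p^2-1)/24 to (p-1)/24, since the limit of -(1-p^{k-1})B_k/(2k) for k=2+p^a(p-1) is (p-1)/24, so the stated value is false for every odd prime p. *)

(* Defs.v *)
From HB Require Import structures.
From mathcomp Require Import all_boot all_order all_algebra finmap ring.
From mathcomp.multinomials Require Import monalg.
From mathcomp Require Import boolp classical_sets functions cardinality fsbigop.
From mathcomp Require Import topology.

Set Implicit Arguments.
Unset Strict Implicit.
Unset Printing Implicit Defensive.

Import Order.TTheory GRing.Theory Num.Theory.
Local Open Scope ring_scope.
Local Open Scope quotient_scope.

(** * The field [Qp] of p-adic numbers *)

Section PadicAbs.

Variables (p : nat) (p_pr : prime p).
Implicit Types x y : rat.

(* The proof [p_pr] is an argument of this and of the following definitions so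
   that the structures on [Qp p_pr] below can be inferred. *)
Definition padic_abs (_ : prime p) x : rat :=
  if x == 0 then 0
  else p%:R ^+ logn p `|denq x|%N / p%:R ^+ logn p `|numq x|%N.

Local Notation abs := (padic_abs p_pr).

Let p_gt0 : (0 : rat) < p%:R. Proof. by rewrite ltr0n prime_gt0. Qed.

Let pX_neq0 n : (p%:R : rat) ^+ n != 0.
Proof. by rewrite expf_neq0 // gt_eqF. Qed.

Lemma padic_abs_frac (a b : int) : a != 0 -> b != 0 ->
  abs (a%:~R / b%:~R) = p%:R ^+ logn p `|b|%N / p%:R ^+ logn p `|a|%N.
Proof.
move=> a0 b0; set x : rat := a%:~R / _.
have b0' : (b%:~R : rat) != 0 by rewrite intr_eq0.
have x0 : x != 0 by rewrite mulf_neq0 ?invr_eq0 ?intr_eq0.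
have n0 : numq x != 0 by rewrite numq_eq0.
have e : (numq x * b = a * denq x)%R.
  apply: (@intr_inj rat); rewrite !intrM.
  have := divq_num_den x; rewrite {3}/x => /eqP.
  by rewrite eqr_div ?intr_eq0 ?denq_neq0 // => /eqP.
have : logn p `|(numq x * b)%R| = logn p `|(a * denq x)%R| by rewrite e.
rewrite !abszM !lognM ?absz_gt0 ?denq_neq0 // => el.
rewrite /padic_abs (negPf x0); apply/eqP.
by rewrite eqr_div // -!exprD addnC -el addnC.
Qed.

Lemma padic_abs0 : abs 0 = 0.
Proof. by rewrite /padic_abs eqxx. Qed.

Lemma padic_abs_gt0 x : x != 0 -> 0 < abs x.
Proof. by move=> x0; rewrite /padic_abs (negPf x0) divr_gt0 ?exprn_gt0. Qed.

Lemma padic_abs_eq0 x : (abs x == 0) = (x == 0).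
Proof.
have [->|x0] := eqVneq x 0; first by rewrite padic_abs0 eqxx.
by rewrite gt_eqF ?padic_abs_gt0.
Qed.

Lemma padic_abs_ge0 x : 0 <= abs x.
Proof.
by have [->|/padic_abs_gt0/ltW //] := eqVneq x 0; rewrite padic_abs0.
Qed.

Lemma padic_absM x y : abs (x * y) = abs x * abs y.
Proof.
have [->|x0] := eqVneq x 0; first by rewrite mul0r padic_abs0 mul0r.
have [->|y0] := eqVneq y 0; first by rewrite mulr0 padic_abs0 mulr0.
have nz z : z != 0 -> numq z != 0 by rewrite numq_eq0.
rewrite -{1}[x]divq_num_den -{1}[y]divq_num_den mulf_div -!intrM.
rewrite padic_abs_frac ?mulf_neq0 ?nz ?denq_neq0 //.
rewrite !abszM !lognM ?absz_gt0 ?nz ?denq_neq0 // /padic_abs.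
by rewrite (negPf x0) (negPf y0) mulf_div -!exprD.
Qed.

Lemma padic_abs1 : abs 1 = 1.
Proof. by rewrite /padic_abs oner_eq0 divff. Qed.

Lemma padic_absN x : abs (- x) = abs x.
Proof. by rewrite /padic_abs oppr_eq0 numqN denqN abszN. Qed.

Lemma padic_absV x : abs x^-1 = (abs x)^-1.
Proof.
have [->|x0] := eqVneq x 0; first by rewrite !(padic_abs0, invr0).
apply: (mulfI (x := abs x)); first by rewrite padic_abs_eq0.
by rewrite -padic_absM !divff ?padic_abs1 ?padic_abs_eq0.
Qed.

Lemma padic_abs_intE (a : int) : a != 0 ->
  abs a%:~R = (p%:R ^+ logn p `|a|)^-1.
Proof.
by move=> a0; rewrite -[a%:~R]divr1 (padic_abs_frac (b := 1)) //= logn1 div1r.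
Qed.

Lemma padic_abs_int (a : int) : abs a%:~R <= 1.
Proof.
have [->|a0] := eqVneq a 0; first by rewrite padic_abs0.
by rewrite padic_abs_intE // invf_le1 ?exprn_gt0 // exprn_ege1 // ler1n prime_gt0.
Qed.

(* The ultrametric inequality, first for [x = 1]. *)
Let padic_absD1 y : abs y <= 1 -> abs (1 + y) <= 1.
Proof.
have [->|y0 ley] := eqVneq y 0; first by rewrite addr0 padic_abs1.
have pNd : ~~ (p %| `|denq y|)%N.
  apply/negP => pd; move: ley; rewrite /padic_abs (negPf y0).
  have pn : ~~ (p %| `|numq y|)%N.
    apply/negP => pn; have := coprime_num_den y; rewrite /coprime.
    move=> /eqP e; have : (p %| gcdn `|numq y| `|denq y|)%N by rewrite dvdn_gcd pn.
    by rewrite e Euclid_dvd1.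
  rewrite [logn p `|numq y|]logn_coprime ?prime_coprime //.
  rewrite expr0 divr1 leNgt => /negP; apply.
  rewrite exprn_egt1 ?ltr1n ?prime_gt1 // -lt0n logn_gt0 mem_primes p_pr pd.
  by rewrite absz_gt0 denq_neq0.
have -> : 1 + y = (denq y + numq y)%:~R / (denq y)%:~R.
  by rewrite intrD mulrDl divq_num_den divff // intr_eq0 denq_neq0.
rewrite padic_absM padic_absV (@padic_abs_intE (denq y)) ?denq_neq0 //.
rewrite logn_coprime ?prime_coprime // expr0 !invr1 mulr1.
exact: padic_abs_int.
Qed.

Lemma padic_abs_ultra x y e : abs x <= e -> abs y <= e -> abs (x + y) <= e.
Proof.
wlog le_yx : x y / abs y <= abs x.
  by move=> h xe ye; case/orP: (le_total (abs y) (abs x)) => ?; [|rewrite addrC];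
     exact: h.
move=> xe ye; have [x0|x0] := eqVneq x 0; first by rewrite x0 add0r.
have -> : x + y = x * (1 + y / x) by rewrite mulrDr mulr1 mulrC divfK.
rewrite padic_absM (le_trans _ xe) // ler_piMr ?padic_abs_ge0 // padic_absD1 //.
by rewrite padic_absM padic_absV ler_pdivrMr ?padic_abs_gt0 // mul1r.
Qed.

Lemma padic_abs_ultra_lt x y e : abs x < e -> abs y < e -> abs (x + y) < e.
Proof.
move=> xe ye; apply: le_lt_trans (_ : Num.max (abs x) (abs y) < e).
  by apply: padic_abs_ultra; rewrite le_max lexx ?orbT.
by rewrite gt_max xe.
Qed.

Lemma padic_abs_isosceles x y : abs y < abs x -> abs (x + y) = abs x.
Proof.
move=> yx; apply/eqP; rewrite eq_le padic_abs_ultra ?lexx ?(ltW yx) //=.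
rewrite leNgt; apply/negP => lt_x; have : abs x < abs x; last by rewrite ltxx.
rewrite -[in X in X < _](addrK y x); apply: padic_abs_ultra_lt => //.
by rewrite padic_absN.
Qed.

End PadicAbs.

(* [Qp] is the completion of [rat] for [padic_abs]: Cauchy sequences of rational
   numbers modulo null sequences. *)
Section Padic.

Variables (p : nat) (p_pr : prime p).
Local Notation abs := (padic_abs p_pr).
Implicit Types u v : nat -> rat.

Definition padic_cauchy : {pred nat -> rat} := fun u =>
  `[< forall e : rat, 0 < e -> exists N, forall m n,
      (N <= m)%N -> (N <= n)%N -> abs (u m - u n) < e >].

Definition padic_tends0 u := forall e : rat, 0 < e ->
  exists N, forall n, (N <= n)%N -> abs (u n) < e.

Lemma padic_cauchy_bounded u : u \in padic_cauchy ->
  exists2 B : rat, 0 < B & forall n, abs (u n) < B.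
Proof.
move=> /asboolP /(_ 1 ltr01) [N hN].
exists (\sum_(i < N.+1) abs (u i) + 1).
  by rewrite ltr_wpDl ?sumr_ge0 // => i _; rewrite padic_abs_ge0.
have le_s i : (i < N.+1)%N -> abs (u i) <= \sum_(i < N.+1) abs (u i).
  move=> iN; rewrite (bigD1 (Ordinal iN)) //= lerDl sumr_ge0 // => j _.
  exact: padic_abs_ge0.
have lt_s x : x <= \sum_(i < N.+1) abs (u i) ->
    x < \sum_(i < N.+1) abs (u i) + 1.
  by move=> h; rewrite (le_lt_trans h) // ltrDl.
move=> n; have [nN|nN] := leqP n N; first by apply: lt_s; apply: le_s.
rewrite -(subrK (u N) (u n)); apply: padic_abs_ultra_lt; last exact/lt_s/le_s.
rewrite (lt_le_trans (hN _ _ (ltnW nN) (leqnn N))) // lerDr sumr_ge0 // => i _.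
exact: padic_abs_ge0.
Qed.

Fact padic_cauchy_subring : subring_closed padic_cauchy.
Proof.
split=> [|u v /asboolP cu /asboolP cv|u v].
- by apply/asboolP => e e0; exists 0%N => m n _ _; rewrite subrr padic_abs0.
- apply/asboolP => e e0; have [N hN] := cu e e0; have [M hM] := cv e e0.
  exists (maxn N M) => m n; rewrite !geq_max => /andP[mN mM] /andP[nN nM].
  have -> : (u - v) m - (u - v) n = (u m - u n) - (v m - v n).
    by rewrite [LHS](_ : _ = (u m - v m) - (u n - v n)) //; ring.
  by apply: padic_abs_ultra_lt; rewrite ?padic_absN ?hN ?hM.
- move=> hu hv; have [B B0 hB] := padic_cauchy_bounded hu.
  have [C C0 hC] := padic_cauchy_bounded hv.
  move: hu hv => /asboolP cu /asboolP cv.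
  apply/asboolP => e e0.
  have [N hN] := cu (e / C) (divr_gt0 e0 C0).
  have [M hM] := cv (e / B) (divr_gt0 e0 B0).
  exists (maxn N M) => m n; rewrite !geq_max => /andP[mN mM] /andP[nN nM].
  have -> : (u * v) m - (u * v) n = u m * (v m - v n) + (u m - u n) * v n.
    by rewrite [LHS](_ : _ = u m * v m - u n * v n) //; ring.
  apply: padic_abs_ultra_lt; rewrite padic_absM.
    have [->|u0] := eqVneq (abs (u m)) 0; first by rewrite mul0r.
    rewrite (lt_le_trans (y := abs (u m) * (e / B))) //.
      by rewrite ltr_pM2l ?hM // lt_neqAle eq_sym u0 padic_abs_ge0.
    by rewrite mulrCA ler_piMr ?(ltW e0) // ler_pdivrMr // mul1r ltW.
  rewrite (le_lt_trans (y := abs (u m - u n) * C)) //.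
    by rewrite ler_wpM2l ?padic_abs_ge0 // ltW.
  by rewrite -ltr_pdivlMr ?hN.
Qed.

Record padic_seq := PadicSeq
  { padic_seq_val :> nat -> rat; _ : padic_seq_val \in padic_cauchy }.

HB.instance Definition _ := [isSub for padic_seq_val].
HB.instance Definition _ := [Choice of padic_seq by <:].
HB.instance Definition _ := GRing.SubChoice_isSubComNzRing.Build
  (nat -> rat) padic_cauchy padic_seq padic_cauchy_subring.

Definition padic_null : {pred padic_seq} := fun x => `[< padic_tends0 x >].

Fact padic_null_ideal : idealr_closed padic_null.
Proof.
split=> [||a x y /asboolP hu /asboolP hv].
- by apply/asboolP => e e0; exists 0%N => n _; rewrite /= padic_abs0.
- apply/negP => /asboolP /(_ 1 ltr01) [N /(_ N (leqnn N))].
  by rewrite /= padic_abs1 ltxx.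
- have [B B0 hB] := padic_cauchy_bounded (valP a).
  apply/asboolP => e e0; have [N hN] := hu (e / B) (divr_gt0 e0 B0).
  have [M hM] := hv e e0; exists (maxn N M) => n; rewrite geq_max => /andP[nN nM].
  apply: padic_abs_ultra_lt; last exact: hM.
  rewrite [X in abs X](_ : _ = val a n * val x n) // padic_absM.
  rewrite (le_lt_trans (y := B * abs (x n))) //.
    by rewrite ler_wpM2r ?padic_abs_ge0 // ltW.
  by rewrite mulrC -ltr_pdivlMr ?hN.
Qed.

HB.instance Definition _ := isIdealr.Build padic_seq padic_null padic_null_ideal.

Definition Qp := {ideal_quot padic_null}.

HB.instance Definition _ := GRing.ComNzRing.on Qp.
HB.instance Definition _ := EqQuotient.on Qp.

Local Notation cls := (\pi_Qp).

Lemma Qp_pi_eq0 (x : padic_seq) : (cls x == 0) = (x \in padic_null).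
Proof.
have -> : (0 : Qp) = cls 0 by exact: esym (lock _).
by rewrite -Quotient.idealrBE subr0.
Qed.

Lemma Qp_piM (x y : padic_seq) : cls (x * y) = cls x * cls y.
Proof. exact: Quotient.pi_mul. Qed.

Lemma Qp_piD (x y : padic_seq) : cls (x + y) = cls x + cls y.
Proof. exact: Quotient.pi_add. Qed.

Lemma Qp_piN (x : padic_seq) : cls (- x) = - cls x.
Proof. exact: Quotient.pi_opp. Qed.

Lemma padic_seq_nonnull (x : padic_seq) : x \notin padic_null ->
  exists2 c, 0 < c & exists N, forall n, (N <= n)%N -> abs (x n) = c.
Proof.
move=> /asboolPn; rewrite /padic_tends0 -existsNE => -[e].
rewrite not_implyE -forallNE => -[e0 he].
have /asboolP/(_ e e0)[N hN] := valP x.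
have := he N; rewrite -existsNE => -[n]; rewrite not_implyE => -[nN /negP].
rewrite -leNgt => lee; exists (abs (x n)); first exact: lt_le_trans lee.
exists N => m mN; rewrite -[x m](subrK (x n)) addrC padic_abs_isosceles //.
exact: lt_le_trans (hN _ _ mN nN) lee.
Qed.

Definition Qp_inv (x : Qp) : Qp :=
  if x == 0 then 0
  else cls (insubd (0 : padic_seq) (fun n => (repr x n)^-1)).

Fact Qp_mulVf (x : Qp) : x != 0 -> Qp_inv x * x = 1.
Proof.
move=> x0; rewrite /Qp_inv (negPf x0).
have x0' : repr x \notin padic_null by rewrite -Qp_pi_eq0 reprK.
have [c c0 [N hN]] := padic_seq_nonnull x0'.
have nz n : (N <= n)%N -> repr x n != 0.
  by move=> /hN xc; rewrite -(padic_abs_eq0 p_pr) xc gt_eqF.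
set y : padic_seq := insubd _ _.
have yE n : y n = (repr x n)^-1.
  rewrite /y [LHS](_ : _ = val (insubd (0 : padic_seq) (fun n => (repr x n)^-1)) n) //.
  rewrite insubdK //; apply/asboolP => e e0.
  have /asboolP/(_ (e * (c * c))) := valP (repr x).
  case=> [|M hM]; first by rewrite !mulr_gt0.
  exists (maxn N M) => m k; rewrite !geq_max => /andP[mN mM] /andP[kN kM].
  have -> : (repr x m)^-1 - (repr x k)^-1 =
      (repr x k - repr x m) / (repr x m * repr x k).
    by field; rewrite !nz.
  rewrite padic_absM padic_absV padic_absM !hN // ltr_pdivrMr ?mulr_gt0 //.
  exact: hM.
rewrite -[X in _ * X]reprK -Qp_piM.
have -> : (1 : Qp) = cls 1 by exact: esym (lock _).
apply/eqP; rewrite -Quotient.idealrBE; apply/asboolP => e e0.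
exists N => n nN.
rewrite [X in abs X](_ : _ = y n * repr x n - 1) //.
by rewrite yE mulVf ?nz // subrr padic_abs0.
Qed.

Fact Qp_inv0 : Qp_inv 0 = 0.
Proof. by rewrite /Qp_inv eqxx. Qed.

HB.instance Definition _ := GRing.ComNzRing_isField.Build Qp Qp_mulVf Qp_inv0.

(* The p-adic absolute value of [x] is the limit of the absolute values of the
   terms of a Cauchy sequence that represents [x]. *)
Definition padic_norm (x : Qp) : rat :=
  xget 0 [set c : rat | forall e : rat, 0 < e ->
    exists N, forall n, (N <= n)%N -> `|abs (repr x n) - c| < e]%classic.

Lemma padic_norm_lim (u : padic_seq) (e : rat) : 0 < e ->
  exists N, forall n, (N <= n)%N -> `|abs (u n) - padic_norm (cls u)| < e.
Proof.
pose v := repr (cls u).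
have uv : padic_tends0 (fun n => u n - v n).
  have : u - v \in padic_null by rewrite Quotient.idealrBE reprK.
  by move=> /asboolP.
have [c hc] : exists c : rat, forall e : rat, 0 < e ->
    exists N, forall n, (N <= n)%N -> `|abs (v n) - c| < e.
  have [/asboolP v0|/padic_seq_nonnull[c _ [N hN]]] := boolP (v \in padic_null).
    exists 0 => d d0; have [N hN] := v0 d d0; exists N => n nN.
    by rewrite subr0 ger0_norm ?padic_abs_ge0 ?hN.
  by exists c => d d0; exists N => n nN; rewrite hN // subrr normr0.
have : [set c : rat | forall e : rat, 0 < e ->
    exists N, forall n, (N <= n)%N -> `|abs (v n) - c| < e]%classic
    (padic_norm (cls u)) by apply: xgetPex; exists c.
move=> hv e0; have e20 : 0 < e / 2 by rewrite divr_gt0.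
have [N hN] := hv _ e20; have [M hM] := uv _ e20.
exists (maxn N M) => n; rewrite geq_max => /andP[nN nM].
rewrite -[X in X - _](subrK (abs (v n))) -addrA (splitr e).
rewrite (le_lt_trans (ler_normD _ _)) // ltrD ?hN //.
have tri a b : abs a - abs b <= abs (a - b).
  rewrite lerBlDr -{1}[a](subrK b); apply: padic_abs_ultra;
  by rewrite ?lerDl ?lerDr ?padic_abs_ge0.
apply: le_lt_trans (hM n nM); rewrite ler_norml tri andbT lerNl opprB.
by rewrite -(padic_absN p_pr (u n - v n)) opprB tri.
Qed.

Lemma padic_norm_le (u : padic_seq) (c : rat) :
  (exists N, forall n, (N <= n)%N -> abs (u n) <= c) ->
  padic_norm (cls u) <= c.
Proof.
move=> [N hN]; rewrite leNgt; apply/negP => lt_c.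
have [M hM] := padic_norm_lim u (e := padic_norm (cls u) - c)
  ltac:(by rewrite subr_gt0).
have := hM (maxn N M) (leq_maxr _ _).
have := hN (maxn N M) (leq_maxl _ _).
rewrite ltr_norml => le_c /andP[+ _]; rewrite opprB ltrBrDr subrK.
by rewrite ltNge le_c.
Qed.

Lemma padic_norm_ge (u : padic_seq) (c : rat) :
  (exists N, forall n, (N <= n)%N -> c <= abs (u n)) ->
  c <= padic_norm (cls u).
Proof.
move=> [N hN]; rewrite leNgt; apply/negP => lt_c.
have [M hM] := padic_norm_lim u (e := c - padic_norm (cls u))
  ltac:(by rewrite subr_gt0).
have := hM (maxn N M) (leq_maxr _ _).
have := hN (maxn N M) (leq_maxl _ _).
rewrite ltr_norml => le_c /andP[_]; rewrite ltrBlDr subrK.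
by rewrite ltNge le_c.
Qed.

Lemma padic_norm_pi (u : padic_seq) (c : rat) :
  (exists N, forall n, (N <= n)%N -> abs (u n) = c) -> padic_norm (cls u) = c.
Proof.
move=> [N hN]; apply/eqP; rewrite eq_le padic_norm_le ?padic_norm_ge //;
by exists N => n /hN ->.
Qed.

Lemma padic_norm_ratr (q : rat) : padic_norm (ratr q) = abs q.
Proof.
have cst_cauchy (a : rat) : (fun _ : nat => a) \in padic_cauchy.
  by apply/asboolP => e e0; exists 0%N => m n _ _; rewrite subrr padic_abs0.
pose cst a : padic_seq := PadicSeq (cst_cauchy a).
have cst_nat (n : nat) : cls (cst n%:R) = n%:R.
  elim: n => [|n IH]; first by rewrite mulr0n; apply/eqP;
    rewrite Qp_pi_eq0; apply/asboolP => e e0; exists 0%N => n _;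
    rewrite [X in abs X](_ : _ = 0) // padic_abs0.
  rewrite -[in RHS]natr1 -IH (_ : (1 : Qp) = cls 1); last exact: esym (lock _).
  rewrite -Qp_piD; congr (cls _); apply: val_inj; apply/funext => k.
  by rewrite -[LHS]/(n.+1%:R) -natr1.
have cst_int (z : int) : cls (cst z%:~R) = z%:~R.
  case: z => n; first by rewrite -!pmulrn cst_nat.
  rewrite NegzE !mulrNz -!pmulrn -cst_nat -Qp_piN; congr (cls _).
  exact: val_inj.
have dn0 : (denq q)%:~R != 0 :> Qp.
  rewrite -cst_int Qp_pi_eq0; apply/asboolPn => /(_ (abs (denq q)%:~R)).
  rewrite padic_abs_gt0 ?intr_eq0 ?denq_neq0 // => /(_ isT)[N /(_ N (leqnn N))].
  by rewrite ltxx.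
have -> : ratr q = cls (cst q).
  rewrite /ratr -[LHS]mulr1 -(mulfK dn0 (cls (cst q))) mulr1; congr (_ / _).
  rewrite -!cst_int -Qp_piM; congr (cls _); apply: val_inj; apply/funext => k.
  by rewrite -[RHS]/(q * (denq q)%:~R) -{2}[q]divq_num_den divfK // intr_eq0 denq_neq0.
by apply: padic_norm_pi; exists 0%N.
Qed.

Lemma padic_norm0 : padic_norm 0 = 0.
Proof.
have -> : (0 : Qp) = cls 0 by exact: esym (lock _).
by apply: padic_norm_pi; exists 0%N => n _; rewrite padic_abs0.
Qed.

Lemma padic_norm_seq (x : Qp) : x != 0 -> 0 < padic_norm x /\
  exists N, forall n, (N <= n)%N -> abs (repr x n) = padic_norm x.
Proof.
rewrite -{1}[x]reprK Qp_pi_eq0 => /padic_seq_nonnull [c c0 hc].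
by rewrite -{1 3}[x]reprK (padic_norm_pi hc).
Qed.

Lemma padic_norm_ge0 (x : Qp) : 0 <= padic_norm x.
Proof.
by have [->|/padic_norm_seq[/ltW]] := eqVneq x 0; rewrite ?padic_norm0.
Qed.

Lemma padic_norm_eq0 (x : Qp) : (padic_norm x == 0) = (x == 0).
Proof.
have [->|/padic_norm_seq[x0 _]] := eqVneq x 0; first by rewrite padic_norm0 eqxx.
by rewrite gt_eqF.
Qed.

Lemma padic_normM (x y : Qp) : padic_norm (x * y) = padic_norm x * padic_norm y.
Proof.
have [->|x0] := eqVneq x 0; first by rewrite mul0r padic_norm0 mul0r.
have [->|y0] := eqVneq y 0; first by rewrite mulr0 padic_norm0 mulr0.
have [_ [N hN]] := padic_norm_seq x0; have [_ [M hM]] := padic_norm_seq y0.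
rewrite -{1}[x]reprK -{1}[y]reprK -Qp_piM; apply: padic_norm_pi.
exists (maxn N M) => n; rewrite geq_max => /andP[nN nM].
rewrite [X in abs X](_ : _ = repr x n * repr y n) //.
by rewrite padic_absM hN ?hM.
Qed.

Lemma padic_normN (x : Qp) : padic_norm (- x) = padic_norm x.
Proof.
have [->|x0] := eqVneq x 0; first by rewrite oppr0.
have [_ [N hN]] := padic_norm_seq x0.
rewrite -{1}[x]reprK -Qp_piN; apply: padic_norm_pi; exists N => n nN.
by rewrite [X in abs X](_ : _ = - repr x n) // padic_absN hN.
Qed.

Lemma padic_norm_ultra (x y : Qp) (e : rat) :
  padic_norm x <= e -> padic_norm y <= e -> padic_norm (x + y) <= e.
Proof.
move=> xe ye; have e0 : 0 <= e by apply: le_trans xe; exact: padic_norm_ge0.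
have ev (z : Qp) : padic_norm z <= e -> forall d, 0 < d ->
    exists N, forall n, (N <= n)%N -> abs (repr z n) <= e + d.
  move=> ze d d0; have [N hN] := padic_norm_lim (repr z) d0.
  exists N => n /hN; rewrite reprK ltr_norml => /andP[_ h].
  by rewrite -lerBlDr (le_trans _ ze) // lerBlDr -lerBlDl ltW.
apply/ler_addgt0Pr => d d0.
have [N hN] := ev x xe d d0; have [M hM] := ev y ye d d0.
rewrite -[x]reprK -[y]reprK -Qp_piD; apply: padic_norm_le.
exists (maxn N M) => n; rewrite geq_max => /andP[nN nM].
rewrite [X in abs X](_ : _ = repr x n + repr y n) //.
by rewrite padic_abs_ultra ?hN ?hM.
Qed.

Lemma padic_norm_ultra_lt (x y : Qp) (e : rat) :
  padic_norm x < e -> padic_norm y < e -> padic_norm (x + y) < e.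
Proof.
move=> xe ye.
apply: le_lt_trans (_ : Num.max (padic_norm x) (padic_norm y) < e).
  by apply: padic_norm_ultra; rewrite le_max lexx ?orbT.
by rewrite gt_max xe.
Qed.

End Padic.

Section Heisenberg.

Variables (p : nat) (p_pr : prime p).
Local Notation K := (Qp p_pr).
Local Notation norm := (@padic_norm p p_pr).

(** * The Heisenberg vertex operator algebra *)

(* The variable of index [i] is h_{-(i+1)}. *)
Definition monom := {cmonom nat}.
Definition Fock := {malg K[{cmonom nat}]}.

HB.instance Definition _ := GRing.ComAlgebra.on Fock.

Implicit Types (m : monom) (v x : Fock).

Definition wt m : nat := (\sum_(i <- finsupp m) m i * i.+1)%N.

(* [heis n] is h(n). For [n > 0], the variable h_{-n} has index [n.-1]; for
   [n = 0] the factor [n * m n.-1] makes h(0) vanish. [Negz i] is -(i+1). *)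
Definition heis (n : int) x : Fock :=
  match n with
  | Posz n =>
      \sum_(m <- msupp x) (x@_m * (n * m n.-1)%N%:R) *: << divcm m (ucm n.-1) >>
  | Negz i => << ucm i >> * x
  end.

(* [mode s n] is the mode v(n) of v = h(-k_1-1) ... h(-k_l-1) 1, where
   s = [:: k_1; ...; k_l], acting on the Fock space, by the formula
     (h(-k-1) w)(n) = \sum_{i >= 0} binom(k+i, i)
       (h(-k-1-i) w(n+i) + (-1)^k w(n-k-1-i) h(i)),
   i.e. Y(h(-k-1) w, z) = :(1/k!) (d/dz)^k Y(h, z) Y(w, z):. On a given vector
   only finitely many terms are nonzero, and the sum below is the sum over its
   finite support. *)
Fixpoint mode (s : seq nat) (n : int) (x : Fock) : Fock :=
  if s is k :: s' then
    \sum_(i \in [set: nat]%classic) 'C((k + i)%N, i)%:R *: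
      (heis (Negz (k + i)) (mode s' (n + i%:Z) x)
       + (-1) ^+ k *: mode s' (n - k.+1%:Z - i%:Z) (heis i%:Z x))
  else if n == -1 then x else 0.

Definition word m : seq nat :=
  flatten [seq nseq (m i) i | i <- sort leq (finsupp m)].

(* The operator o(v): the mode v(k-1) on the part of weight k. *)
Definition zero_mode v x : Fock :=
  \sum_(m <- msupp v) v@_m *: mode (word m) ((wt m)%:Z - 1) x.

(* The trace of o(v) on the weight [n] subspace, in the basis of monomials. *)
Definition graded_trace v (n : nat) : K :=
  \sum_(m \in [set m | wt m = n]%classic) (zero_mode v << m >>)@_m.

(** * q-expansions *)

(* The function [g] stands for the series \sum_n g(n) q^n. *)
Definition qser := nat -> K^o.

HB.instance Definition _ := GRing.Lmodule.on qser.

Implicit Types g : qser.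

Definition qmul g1 g2 : qser := fun n => \sum_(i < n.+1) g1 i * g2 (n - i)%N.
Definition qone : qser := fun n => (n == 0%N)%:R.
Definition qexp g k : qser := iter k (qmul g) qone.

(* \prod_{n >= 1} (1 - q^n): the coefficient of q^n only involves the first [n]
   factors. *)
Definition euler_prod : qser :=
  fun n => (\prod_(1 <= i < n.+1) (1 - 'X^i) : {poly K})`_n.

(* eta(q) Z(v, q), where the powers q^(1/24) and q^(-1/24) cancel. *)
Definition normalized_character v : qser := qmul euler_prod (graded_trace v).

(** * Bernoulli numbers and Eisenstein series *)

(* [bern_egf n] lists the first [n] coefficients B_k / k! of z / (e^z - 1),
   computed by inverting (e^z - 1) / z; see [bernoulli_egf]. *)
Fixpoint bern_egf (n : nat) : seq rat :=
  if n is n'.+1 then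
    let s := bern_egf n' in
    rcons s ((n' == 0%N)%:R - \sum_(k < n') s`_k / (n'.+1 - k)`!%:R)
  else [::].

Definition bernoulli (n : nat) : rat := n`!%:R * (bern_egf n.+1)`_n.

Lemma bernoulli_egf (n : nat) :
  \sum_(k < n.+1) (bernoulli k / k`!%:R) * (1 / (n.+1 - k)`!%:R) = (n == 0%N)%:R.
Proof.
have size_b k : size (bern_egf k) = k by elim: k => //= k IH; rewrite size_rcons IH.
have nth_b k l : (k < l)%N -> (bern_egf l)`_k = bernoulli k / k`!%:R.
  rewrite /bernoulli mulrAC divff ?pnatr_eq0 -?lt0n ?fact_gt0 // mul1r.
  elim: l => // l IH; rewrite ltnS leq_eqVlt => /predU1P[-> //|kl].
  by rewrite [LHS]/= nth_rcons size_b kl IH.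
rewrite big_ord_recr /= subSnn (_ : 1`!%:R = 1 :> rat) // divr1 ?mulr1.
rewrite -(nth_b n n.+1) //=.
rewrite nth_rcons size_b ltnn eqxx addrC -addrA -[RHS]addr0; congr (_ + _).
apply/eqP; rewrite addrC subr_eq0; apply/eqP/eq_bigr => k _.
by rewrite nth_b // div1r.
Qed.

Definition sigma (k n : nat) : nat := (\sum_(d <- divisors n) d ^ k)%N.

Definition eisensteinE (k : nat) : qser := fun n =>
  if n == 0%N then 1
  else - ratr (k.*2%:R / bernoulli k) * (sigma k.-1 n)%:R.

Definition eisensteinG (k : nat) : qser := fun n =>
  if n == 0%N then - ratr (bernoulli k / k.*2%:R) else (sigma k.-1 n)%:R.

(* The constant term of the p-stabilization G_2(q) - p G_2(q^p) of
   G_2 = -1/24 + ... is (p-1)/24. *)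
Definition eisensteinG2_stab : qser := fun n =>
  if n == 0%N then ratr (p.-1%:R / 24%:R)
  else (\sum_(d <- divisors n | coprime d p) d)%N%:R.

(** * The completions [S1] and [Mp] *)

(* The completion of [Fock] for the sup-norm: the families of coefficients,
   indexed by monomials, that tend to zero. *)
Definition S1_pred : {pred monom -> K^o} := fun c =>
  `[< forall e : rat, 0 < e -> finite_set [set m | e <= norm (c m)]%classic >].

Fact S1_submod : submod_closed S1_pred.
Proof.
split=> [|a b c /asboolP hb /asboolP hc]; apply/asboolP => e e0.
  rewrite [X in finite_set X](_ : _ = set0)%classic ?finite_set0 //.
  apply/seteqP; split=> // m /=.
  by rewrite padic_norm0 leNgt e0.
have hab : finite_set [set m | e <= norm (a * b m)]%classic.
  have [a0|a0] := eqVneq (norm a) 0.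
    rewrite [X in finite_set X](_ : _ = set0)%classic ?finite_set0 //.
    by apply/seteqP; split=> // m /=; rewrite padic_normM a0 mul0r leNgt e0.
  have a_gt0 : 0 < norm a by rewrite lt_neqAle eq_sym a0 padic_norm_ge0.
  apply: sub_finite_set (hb (e / norm a) (divr_gt0 e0 a_gt0)) => m /=.
  by rewrite padic_normM ler_pdivrMr // mulrC.
apply: (sub_finite_set (B := [set m | e <= norm (a * b m)] `|`
   [set m | e <= norm (c m)])%classic); last by rewrite finite_setU; split; [|exact: hc].
move=> m /= h; apply: contrapT; rewrite not_orE => -[/negP + /negP].
rewrite -!ltNge => h1 h2; move: h; rewrite leNgt => /negP; apply.
exact: padic_norm_ultra_lt.
Qed.

HB.instance Definition _ :=
  GRing.isSubmodClosed.Build K (monom -> K^o) S1_pred S1_submod.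

Record S1 := MkS1 { S1_coef :> monom -> K^o; _ : S1_coef \in S1_pred }.

HB.instance Definition _ := [isSub for S1_coef].
HB.instance Definition _ := [Choice of S1 by <:].
HB.instance Definition _ := [SubChoice_isSubLmodule of S1 by <:].

Fact S1_of_subproof v : (fun m => v@_m) \in S1_pred.
Proof.
apply/asboolP => e e0; apply: sub_finite_set (finite_fset (msupp v)) => m /= em.
rewrite -mcoeff_neq0; apply: contraTneq em => ->.
by rewrite padic_norm0 -ltNge.
Qed.

Definition S1_of v : S1 := MkS1 (S1_of_subproof v).

(* The subspace Q_p[E_4, E_6] of the q-series, and its closure for the
   sup-norm. *)
Definition polyE46 g := exists N (c : nat -> nat -> K),
  g = \sum_(i < N) \sum_(j < N)
        c i j *: qmul (qexp (eisensteinE 4) i) (qexp (eisensteinE 6) j).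

Definition Mp_pred : {pred qser} := fun g =>
  `[< forall e : rat, 0 < e ->
      exists2 h, polyE46 h & forall n, norm (g n - h n) < e >].

Fact polyE46_submod a g h : polyE46 g -> polyE46 h -> polyE46 (a *: g + h).
Proof.
move=> [N [b ->]] [M [c ->]].
have wide (L L' : nat) (d : nat -> nat -> K) : (L <= L')%N ->
    \sum_(i < L) \sum_(j < L)
      d i j *: qmul (qexp (eisensteinE 4) i) (qexp (eisensteinE 6) j)
    = \sum_(i < L') \sum_(j < L') (if (i < L)%N && (j < L)%N then d i j else 0)
        *: qmul (qexp (eisensteinE 4) i) (qexp (eisensteinE 6) j).
  move=> le_L; rewrite (big_ord_widen L' (fun i => \sum_(j < L)
      d i j *: qmul (qexp (eisensteinE 4) i) (qexp (eisensteinE 6) j)) le_L).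
  rewrite big_mkcond; apply: eq_bigr => i _; case: ifP => iL; last first.
    by rewrite big1 // => j _; rewrite scale0r.
  rewrite (big_ord_widen L' (fun j =>
      d i j *: qmul (qexp (eisensteinE 4) i) (qexp (eisensteinE 6) j)) le_L).
  rewrite big_mkcond; apply: eq_bigr => j _.
  by case: ifP => jL //; rewrite scale0r.
rewrite (wide N _ b (leq_maxl N M)) (wide M _ c (leq_maxr N M)).
exists (maxn N M), (fun i j =>
  a * (if (i < N)%N && (j < N)%N then b i j else 0)
  + (if (i < M)%N && (j < M)%N then c i j else 0)).
rewrite scaler_sumr -big_split; apply: eq_bigr => i _ /=.
rewrite scaler_sumr -big_split; apply: eq_bigr => j _ /=.
by rewrite scalerA -scalerDl.
Qed.

Fact Mp_submod : submod_closed Mp_pred.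
Proof.
split=> [|a g g' /asboolP hg /asboolP hg']; apply/asboolP => e e0.
  exists 0 => [|n]; last by rewrite subrr padic_norm0.
  by exists 0%N, (fun _ _ => 0); rewrite big_ord0.
have [d d0 hd] : exists2 d : rat, 0 < d & norm a * d <= e.
  have a0 := padic_norm_ge0 a; exists (e / (norm a + 1)).
    by rewrite divr_gt0 // ltr_wpDl.
  rewrite mulrCA ler_piMr ?(ltW e0) // ler_pdivrMr ?ltr_wpDl //.
  by rewrite mul1r lerDl.
have [h hh gh] := hg d d0; have [h' hh' gh'] := hg' e e0.
exists (a *: h + h'); first exact: polyE46_submod.
move=> n; have -> : (a *: g + g') n - (a *: h + h') n =
    a * (g n - h n) + (g' n - h' n).
  by rewrite [LHS](_ : _ = (a * g n + g' n) - (a * h n + h' n)) //; ring.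
apply: padic_norm_ultra_lt => //; rewrite padic_normM.
have [->|a0] := eqVneq (norm a) 0; first by rewrite mul0r.
apply: lt_le_trans hd; rewrite ltr_pM2l //.
by rewrite lt_neqAle eq_sym a0 padic_norm_ge0.
Qed.

HB.instance Definition _ :=
  GRing.isSubmodClosed.Build K qser Mp_pred Mp_submod.

Record Mp := MkMp { Mp_qexp :> qser; _ : Mp_qexp \in Mp_pred }.

HB.instance Definition _ := [isSub for Mp_qexp].
HB.instance Definition _ := [Choice of Mp by <:].
HB.instance Definition _ := [SubChoice_isSubLmodule of Mp by <:].

(* The sup-norm topologies. As absolute values are integral powers of p or 0,
   suprema are attained, and the open ball of radius [e] is given by a bound on
   each coefficient. *)
Section SupBall.

Variables (I : Type) (T : choiceType) (coef : T -> I -> K).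

Definition sup_ball (x : T) (e : rat) : set T :=
  [set y | forall i, norm (coef x i - coef y i) < e]%classic.

Lemma sup_ball_center (x : T) (e : rat) : 0 < e -> sup_ball x e x.
Proof. by move=> e0 i; rewrite subrr padic_norm0. Qed.

Lemma sup_ball_sym (x y : T) (e : rat) : sup_ball x e y -> sup_ball y e x.
Proof. by move=> h i; rewrite -padic_normN opprB. Qed.

Lemma sup_ball_triangle (x y z : T) (e1 e2 : rat) :
  sup_ball x e1 y -> sup_ball y e2 z -> sup_ball x (e1 + e2) z.
Proof.
move=> h1 h2 i; rewrite -[_ - _](subrKA (coef y i)).
have e1_gt0 : 0 < e1 by apply: le_lt_trans (h1 i); exact: padic_norm_ge0.
have e2_gt0 : 0 < e2 by apply: le_lt_trans (h2 i); exact: padic_norm_ge0.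
apply: padic_norm_ultra_lt; first by rewrite (lt_trans (h1 i)) // ltrDl.
by rewrite (lt_trans (h2 i)) // ltrDr.
Qed.

End SupBall.

HB.instance Definition _ := hasNbhs.Build S1
  (nbhs_ (entourage_ (sup_ball S1_coef))).
HB.instance Definition _ := @Nbhs_isPseudoMetric.Build rat S1
  (entourage_ (sup_ball S1_coef)) erefl (sup_ball S1_coef)
  (@sup_ball_center _ _ S1_coef) (@sup_ball_sym _ _ S1_coef)
  (@sup_ball_triangle _ _ S1_coef) erefl.

HB.instance Definition _ := hasNbhs.Build Mp
  (nbhs_ (entourage_ (sup_ball Mp_qexp))).
HB.instance Definition _ := @Nbhs_isPseudoMetric.Build rat Mp
  (entourage_ (sup_ball Mp_qexp)) erefl (sup_ball Mp_qexp)
  (@sup_ball_center _ _ Mp_qexp) (@sup_ball_sym _ _ Mp_qexp)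
  (@sup_ball_triangle _ _ Mp_qexp) erefl.

Lemma S1_of_dense (c : S1) (e : rat) : 0 < e -> exists v, ball c e (S1_of v).
Proof.
move=> e0; have /asboolP/(_ e e0) hc := valP c.
exists (\sum_(m <- fset_set [set m | e <= norm (c m)]%classic) << c m *g m >>).
move=> m /=; rewrite raddf_sum /=.
under eq_bigr do rewrite mcoeffU.
have [em|em] := boolP (e <= norm (c m)).
  rewrite (big_fsetD1 m) /=; last by rewrite in_fset_set // inE.
  rewrite eqxx mulr1n big1_fset ?addr0 ?subrr ?padic_norm0 // => k.
  by rewrite !inE => /andP[/negPf ->].
rewrite big1_fset ?subr0; first by rewrite ltNge.
move=> k; rewrite in_fset_set // inE /= => ek _.
by have [ekm|//] := eqVneq k m; rewrite -ekm ek in em.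
Qed.

(** * The states u_r *)

Definition coef_c (r m : nat) : int :=
  \sum_(j < m.+1) (-1) ^+ (m + j) * ('C(m, j) * j.+1 ^ r.-1)%N%:Z.

(* The sum over [m] stops at [r] because c(r, m) = 0 for m >= r. *)
Definition state_u (r : nat) : Fock :=
  (1 - p%:R ^+ r) *:
    (\sum_(m < r) (coef_c r m)%:~R *: heis (Negz m) (heis (Negz 0) 1)
     - ratr (bernoulli r.+1 / r.+1%:R) *: 1).

(* [f] is the continuous linear extension of v |-> eta(q) Z(v, q). *)
Definition is_character_map (f : {linear S1 -> Mp}) : Prop :=
  continuous f /\ forall v : Fock, f (S1_of v) = normalized_character v :> qser.

End Heisenberg.

(* Main.v *)
Require Import Defs.
From mathcomp Require Import all_boot all_order all_algebra finmap ring lra zify.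
From mathcomp.multinomials Require Import monalg.
From mathcomp Require Import boolp classical_sets functions cardinality fsbigop.
From mathcomp Require Import topology cyclic.

Set Implicit Arguments.
Unset Strict Implicit.
Unset Printing Implicit Defensive.

Import Order.TTheory GRing.Theory Num.Theory.
Local Open Scope ring_scope.

(** Continuity of [f] reduces the theorem to the states u_r themselves. The
limit u_1' is written down coefficient by coefficient ([u_lim]), and the
q-expansion of its image is the coefficientwise limit of the characters of the
u_r, for r = 1 + p^a (p - 1). The series lie in [Mp] because they are values of
[f].

The character of u_r. By the iterate formula, the zero mode of
h_{-k-1} h_{-1} is a sum over j >= 1 of h(-j) h(j), with coefficient
(-1)^k C(k+j, k) + C(j-1, k). As polynomials in j these are the values of
binom(x, k) at x = -j-1 and at x = j-1. The numbers c(r, k) are the Newton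
coefficients of (x+1)^(r-1), so summing over k gives
(-j)^(r-1) + j^(r-1) = 2 j^(r-1) for odd r ([coef_c_neg], [coef_c_pos]). Since
h(-j) h(j) multiplies a monomial by j times its exponent in h_{-j}, the zero
mode of u_r is diagonal on monomials ([zero_mode_state_u]). The trace then
counts parts of size j in partitions of n; multiplication by the Euler product
turns this count into the indicator of the multiples of j
([euler_part_mult]), and the result is 2 (1 - p^r) G_{r+1}
([character_state_u]).

The limits. Both c(r, m) and the divisor sums involve r only through powers
x^(r-1), and x^(p^a (p-1)) is congruent modulo p^(a+1) to 1 or 0 according to
whether p divides x ([expn_weight_seq]). The congruences are uniform in m, and
c(r, m) vanishes for m >= r, hence the limit of the coefficients lies in [S1].

The constant terms (1 - p^r) B_{r+1} / (r+1) need a Kummer congruence that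
remains valid for p = 3, where p - 1 divides r + 1. It is obtained from the
numbers E_m = 2 (1 - 2^(m+1)) B_{m+1} / (m+1), the coefficients of 2 / (e^t + 1):
the alternating power sum over j < N of (-1)^j j^m is congruent to E_m modulo N
for odd N ([altsum_euler_num]). With N a power of p, removing the multiples of p
from the sum replaces E_m by (1 - p^m) E_m, and what remains is governed by the
same congruence for x^(r-1) ([euler_num_stab]). The factor 1 - 2^(r+1) tends to
-3, which is not zero, so it can be divided out ([bernoulli_stab_cvg]). *)

(** * Bernoulli numbers and the coefficients of 2 / (e^t + 1) *)

Section EulerNumbers.

Lemma poly_low0 (R : nzRingType) (n : nat) (P : {poly R}) :
  (forall i, (i < n)%N -> P`_i = 0) -> exists s, P = s * 'X^n.
Proof.
move=> P0; exists (drop_poly n P); rewrite -[LHS](poly_take_drop n).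
rewrite [X in X + _](_ : _ = 0) ?add0r //; apply/polyP => i.
by rewrite coef_take_poly coef0; case: ifP => // /P0.
Qed.

(** The value at 0 of the m-th derivative of 2 / (e^t + 1). *)
Definition euler_num (m : nat) : rat :=
  2 * (1 - 2 ^+ m.+1) * (bernoulli m.+1 / m.+1%:R).

Lemma fact_rat_neq0 n : n`!%:R != 0 :> rat.
Proof. by rewrite pnatr_eq0 -lt0n fact_gt0. Qed.

Lemma euler_num_fact m :
  euler_num m / m`!%:R = 2 * ((1 - 2 ^+ m.+1) * (bernoulli m.+1 / m.+1`!%:R)).
Proof.
by rewrite /euler_num factS natrM invfM !mulrA.
Qed.

Lemma bin_rat (m i : nat) : (i <= m)%N ->
  'C(m, i)%:R = m`!%:R / (i`!%:R * (m - i)`!%:R) :> rat.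
Proof.
move=> im; rewrite -(bin_fact im) natrM natrM mulfK //.
by rewrite mulf_neq0 ?fact_rat_neq0.
Qed.

(** Let b(t) = t / (e^t - 1), so that d is the coefficient sequence of
b(t) - b(2t). From b(2t) (e^(2t) - 1) = 2t and e^(2t) - 1 = (e^t - 1)(e^t + 1) one
gets (b(t) - b(2t)) (e^t + 1) (e^t - 1) = t (e^t - 1), and e^t - 1 cancels. The
power series are represented by polynomials modulo a power of 'X, and
e^t - 1 = t u with u(0) = 1 costs one order of precision. *)
Lemma bernoulli_dilate n :
  let d i : rat := (1 - 2 ^+ i) * (bernoulli i / i`!%:R) in
  d n + \sum_(i < n.+1) d i / (n - i)`!%:R = (n == 1%N)%:R.
Proof.
move=> d.
pose N := n.+2.
pose b := \poly_(i < N) (bernoulli i / i`!%:R : rat).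
pose b2 := \poly_(i < N) (2 ^+ i * (bernoulli i / i`!%:R) : rat).
pose e := \poly_(i < N) ((i`!%:R)^-1 : rat).
pose e2 := \poly_(i < N) (2 ^+ i / i`!%:R : rat).
have e0 : e`_0 = 1 by rewrite coef_poly /= fact0 invr1.
have e10 : (e - 1)`_0 = 0 by rewrite coefB e0 coef1 subrr.
have beE (c : rat) i : (i < N)%N ->
    ((\poly_(i < N) (c ^+ i * (bernoulli i / i`!%:R))) *
      (\poly_(i < N) (c ^+ i / i`!%:R) - 1))`_i = c * (i == 1%N)%:R.
  move=> iN; rewrite coefM; case: i iN => [|i] iN.
    rewrite big_ord1 subnn coefB !coef_poly /= coef1.
    by rewrite expr0 fact0 mul1r invr1 subrr !mulr0.
  rewrite big_ord_recr /= subnn coefB [_`_0]coef_poly /= coef1.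
  rewrite expr0 fact0 mul1r invr1 subrr mulr0 addr0.
  under eq_bigr => j _.
    have ji : (j < i.+1)%N by [].
    rewrite coefB !coef_poly (ltn_trans ji iN).
    rewrite (leq_ltn_trans (leq_subr _ _) iN) coef1 subn_eq0 leqNgt ji subr0.
    rewrite mulrACA -exprD subnKC ?(ltnW ji) // -[(_ - _)`!%:R^-1]div1r.
    over.
  rewrite -mulr_sumr bernoulli_egf; case: i iN => [|i] _ /=; last by rewrite !mulr0.
  by rewrite expr1 mulr1.
have [s1 h1] : exists s, b * (e - 1) - 'X = s * 'X^N.
  apply: poly_low0 => i iN; have := beE 1 i iN.
  have -> : \poly_(j < N) (1 ^+ j * (bernoulli j / j`!%:R)) = b.
    by apply: eq_poly => j _; rewrite expr1n mul1r.
  have -> : \poly_(j < N) (1 ^+ j / j`!%:R) = e :> {poly rat}.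
    by apply: eq_poly => j _; rewrite expr1n mul1r.
  by rewrite coefB coefX mul1r => ->; rewrite subrr.
have [s2 h2] : exists s, b2 * (e2 - 1) - 2%:P * 'X = s * 'X^N.
  apply: poly_low0 => i iN; have := beE 2 i iN.
  by rewrite coefB coefCM coefX => ->; rewrite subrr.
have [s3 h3] : exists s, e2 - e * e = s * 'X^N.
  apply: poly_low0 => i iN; rewrite coefB coefM coef_poly iN.
  apply/eqP; rewrite subr_eq0; apply/eqP.
  rewrite -[2]/(1 + 1 : rat) exprDn mulr_suml; apply: eq_bigr => j _.
  have ji : (j <= i)%N by rewrite -ltnS.
  rewrite !expr1n !mulr1 !coef_poly (leq_ltn_trans ji iN).
  rewrite (leq_ltn_trans (leq_subr _ _) iN).
  rewrite bin_rat //; field; by rewrite !fact_rat_neq0.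
have [u hu] : exists u, e - 1 = u * 'X^1.
  by apply: poly_low0 => -[|//] _.
have D : ((b - b2) * (e + 1) - 'X) * (e - 1) =
    (s1 * (e + 1) - s2 + b2 * s3) * 'X^N.
  have -> : ((b - b2) * (e + 1) - 'X) * (e - 1) =
    (b * (e - 1) - 'X) * (e + 1) - (b2 * (e2 - 1) - 2%:P * 'X) + b2 * (e2 - e * e).
    rewrite -[2%:P]/((1 + 1)%:P) polyCD polyC1; ring.
  by rewrite h1 h2 h3; ring.
have Dn : dvdp 'X^(n.+1) ((b - b2) * (e + 1) - 'X).
  have u0 : coprimep 'X^(n.+1) u.
    apply: coprimep_expl; rewrite coprimep_sym coprimepX /root horner_coef0.
    have : (e - 1)`_1 = 1 by rewrite coefB coef_poly coef1 /= subr0 invr1.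
    by rewrite hu coefMXn /= => ->; rewrite oner_eq0.
  rewrite -(Gauss_dvdpl _ u0) -(@dvdp_mul2r _ 'X) ?polyX_eq0 //.
  by rewrite -exprSr -mulrA -[X in u * X]expr1 -hu D dvdp_mull.
have Dn0 : ((b - b2) * (e + 1) - 'X)`_n = 0.
  by have [q ->] := dvdpP _ _ Dn; rewrite coefMXn ltnS leqnn.
have dE i : (i < N)%N -> (b - b2)`_i = d i.
  by move=> iN; rewrite coefB !coef_poly iN /d mulrBl mul1r.
move/eqP: Dn0; rewrite coefB coefX subr_eq0 => /eqP <-.
have nN : (n < N)%N by exact: leqW.
rewrite [in RHS]mulrDr mulr1 coefD [RHS]addrC dE //; congr (_ + _).
rewrite coefM; apply: eq_bigr => i _.
have iN : (i < N)%N by apply: leq_trans (ltn_ord i) _; rewrite leqW.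
by rewrite dE // coef_poly (leq_ltn_trans (leq_subr _ _)).
Qed.

(** The coefficient form of E(t) + E(t) e^t = 2. *)
Lemma euler_num_rec m :
  euler_num m + \sum_(i < m.+1) 'C(m, i)%:R * euler_num i = 2 * (m == 0%N)%:R.
Proof.
have h := bernoulli_dilate m.+1.
rewrite /= big_ord_recl /= expr0 subrr !mul0r add0r eqSS in h.
have -> : (m == 0%N)%:R = m`!%:R * (m == 0%N)%:R :> rat.
  by case: m {h} => [|m]; rewrite ?fact0 ?mul1r ?mulr0.
rewrite -h mulrDr mulrDr mulrCA -euler_num_fact mulrCA mulfV ?fact_rat_neq0 // mulr1.
congr (_ + _); rewrite mulrCA mulr_sumr mulr_sumr; apply: eq_bigr => i _.
have im : (i <= m)%N by rewrite -ltnS.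
rewrite bin_rat // /bump /= add1n subSS (mulrA 2) -euler_num_fact.
by field; rewrite !fact_rat_neq0.
Qed.

End EulerNumbers.

(** * Alternating power sums and the Kummer congruence *)

Section AlternatingSums.

Variables (p : nat) (p_pr : prime p).
Hypothesis p_odd : odd p.
Local Notation abs := (padic_abs p_pr).

Lemma padic_abs_sum (I : Type) (s : seq I) (P : pred I) (F : I -> rat) (e : rat) :
  0 <= e -> (forall i, P i -> abs (F i) <= e) -> abs (\sum_(i <- s | P i) F i) <= e.
Proof.
move=> e0 h; elim/big_rec: _ => [|i x Pi hx]; first by rewrite padic_abs0.
exact: padic_abs_ultra (h i Pi) hx.
Qed.

Lemma padic_abs_nat (n : nat) : abs n%:R <= 1.
Proof. by have := padic_abs_int p_pr n; rewrite -pmulrn. Qed.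

Lemma padic_abs_pX n : abs (p%:R ^+ n) = (p%:R ^+ n)^-1.
Proof.
have p0 : (0 < p)%N := prime_gt0 p_pr.
have := @padic_abs_intE p p_pr (p ^ n)%N%:Z.
rewrite -pmulrn natrX absz_nat pfactorK // => -> //.
by rewrite eqz_nat expn_eq0 gtn_eqF.
Qed.

Lemma padic_abs_coprime n : coprime n p -> abs n%:R = 1.
Proof.
move=> cn; have n0 : (n != 0)%N.
  by apply: contraTneq cn => ->; rewrite /coprime gcd0n gtn_eqF ?prime_gt1.
have := @padic_abs_intE p p_pr n; rewrite -pmulrn absz_nat => -> //.
by rewrite logn_coprime ?expr0 ?invr1 // coprime_sym.
Qed.

Lemma padic_abs_dvd (z : int) n :
  ((p ^ n)%N%:Z %| z)%Z -> abs z%:~R <= (p%:R ^+ n)^-1.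
Proof.
move=> /dvdzP[q ->]; rewrite intrM padic_absM -pmulrn natrX padic_abs_pX.
by rewrite ler_piMl ?padic_abs_int // invr_ge0 exprn_ge0.
Qed.

Lemma padic_abs_sign n x : abs ((-1) ^+ n * x) = abs x.
Proof. by rewrite -signr_odd mulr_sign fun_if padic_absN if_same. Qed.

Definition altsum (m N : nat) : rat := \sum_(j < N) (-1) ^+ j * j%:R ^+ m.

(** Shifting the summation index by one reverses the sign of the alternating sum
up to its two boundary terms, which add because N is odd. For N = 0 in the
boundary term N^m, this is the recurrence of [euler_num_rec]. *)
Lemma altsum_rec m N : odd N ->
  altsum m N + \sum_(i < m.+1) 'C(m, i)%:R * altsum i N
  = (m == 0%N)%:R + N%:R ^+ m.
Proof.
move=> oN.
have -> : \sum_(i < m.+1) 'C(m, i)%:R * altsum i N =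
    \sum_(j < N) (-1) ^+ j * j.+1%:R ^+ m.
  under eq_bigr do rewrite mulr_sumr.
  rewrite exchange_big; apply: eq_bigr => j _ /=.
  rewrite -natr1 addrC exprDn mulr_sumr; apply: eq_bigr => i _.
  by rewrite expr1n mul1r mulrCA mulr_natl.
have -> : altsum m N = (m == 0%N)%:R + N%:R ^+ m
    + \sum_(j < N) (-1) ^+ j.+1 * j.+1%:R ^+ m.
  have := erefl (\sum_(j < N.+1) (-1) ^+ j * j%:R ^+ m : rat).
  rewrite {1}big_ord_recr big_ord_recl /= -/(altsum m N) expr0 mul1r.
  rewrite -signr_odd oN expr1 mulN1r expr0n => e.
  by rewrite -[altsum m N](subrK (N%:R ^+ m)) e addrAC.
rewrite -addrA -big_split big1 ?addr0 //= => j _.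
by rewrite exprS mulN1r mulNr addNr.
Qed.

Lemma padic_abs2 : abs 2 = 1.
Proof. by apply: padic_abs_coprime; rewrite coprime2n. Qed.

(** The recurrences [altsum_rec] and [euler_num_rec] differ by N^m - 0^m, which is
divisible by N, and 2 is a p-adic unit, so the congruence propagates. *)
Lemma altsum_euler_num m N : odd N -> abs (altsum m N - euler_num m) <= abs N%:R.
Proof.
move=> oN; elim/ltn_ind: m => m IH.
have h := altsum_rec m oN; have h' := euler_num_rec m.
rewrite big_ord_recr /= binn mul1r in h; rewrite big_ord_recr /= binn mul1r in h'.
have e : 2 * (altsum m N - euler_num m) = (N%:R ^+ m - (m == 0%N)%:R)
   - \sum_(i < m) 'C(m, i)%:R * (altsum i N - euler_num i).
  under eq_bigr do rewrite mulrBr.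
  rewrite sumrB; lra.
have -> : abs (altsum m N - euler_num m) = abs (2 * (altsum m N - euler_num m)).
  by rewrite padic_absM padic_abs2 mul1r.
rewrite e.
apply: padic_abs_ultra.
  case: m {IH h h' e} => [|m]; first by rewrite expr0 subrr padic_abs0 padic_abs_ge0.
  rewrite subr0 exprS padic_absM ler_piMr ?padic_abs_ge0 // -natrX.
  exact: padic_abs_nat.
rewrite padic_absN; apply: padic_abs_sum => [|i _]; first exact: padic_abs_ge0.
rewrite padic_absM (le_trans _ (IH i (ltn_ord i))) //.
by rewrite ler_piMl ?padic_abs_ge0 ?padic_abs_nat.
Qed.

Lemma sum_multiples (V : nmodType) (d M : nat) (F : nat -> V) : (0 < d)%N ->
  \sum_(j < d * M | (d %| j)%N) F j = \sum_(i < M) F (d * i)%N.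
Proof.
move=> d0; have lt (i : 'I_M) : (d * i < d * M)%N by rewrite ltn_pmul2l.
case: M lt => [|M] lt; first by rewrite muln0 !big_ord0.
rewrite (reindex_onto (fun i => Ordinal (lt i))
  (fun j : 'I_(d * M.+1) => inord (j %/ d))) /=.
  apply: eq_bigl => i; rewrite dvdn_mulr //=.
  by apply/eqP; apply: val_inj; rewrite /= inordK mulKn.
move=> j dj; apply: val_inj => /=.
have jM : (j %/ d < M.+1)%N by rewrite ltn_divLR // [X in (_ < X)%N]mulnC.
by rewrite (inordK jM) mulnC divnK.
Qed.

(** Since p is odd, (-1)^(p i) = (-1)^i, and the multiples of p contribute p^m times
a shorter sum of the same kind. *)
Lemma altsum_stab m M :
  altsum m (p * M) - p%:R ^+ m * altsum m M =
  \sum_(j < p * M | ~~ (p %| j)%N) (-1) ^+ j * j%:R ^+ m.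
Proof.
rewrite /altsum (bigID (fun j : 'I__ => p %| j)%N) /=.
rewrite (sum_multiples M (fun j => (-1) ^+ j * j%:R ^+ m)) ?prime_gt0 //.
rewrite addrC mulr_sumr [X in _ + X - _](_ : _ =
  \sum_(i < M) p%:R ^+ m * ((-1) ^+ i * i%:R ^+ m)) ?addrK //.
apply: eq_bigr => i _; rewrite natrM exprMn mulrCA.
by rewrite -signr_odd oddM p_odd signr_odd.
Qed.

Definition weight_seq a := (1 + p ^ a * (p - 1))%N.

Lemma ltn_weight_seq a : (a.+1 < weight_seq a)%N.
Proof.
rewrite /weight_seq add1n ltnS (leq_trans (ltn_expl a (prime_gt1 p_pr))) //.
by rewrite leq_pmulr // subn_gt0 prime_gt1.
Qed.

(** Euler's theorem modulo p^(a+1) if p does not divide x; otherwise the exponent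
p^a (p-1) exceeds a. *)
Lemma expn_weight_seq (a x : nat) :
  ((p ^ a.+1)%N%:Z %| (x ^ (weight_seq a).-1)%N%:Z - (coprime x p)%:Z)%Z.
Proof.
rewrite /weight_seq add1n /=.
have [cx|cx] := boolP (coprime x p).
  have := Euler_exp_totient (coprimeXr a.+1 cx).
  rewrite totient_pfactor // mulnC /= => h.
  by rewrite subn1 -eqz_mod_dvd !modz_nat eqz_nat h.
move: cx; rewrite coprime_sym prime_coprime // negbK => cx; rewrite subr0 /dvdz /=.
apply: dvdn_trans (dvdn_exp2r _ cx); apply: dvdn_exp2l.
by have := ltn_weight_seq a; rewrite /weight_seq add1n ltnS.
Qed.

(** Both (1 - p^r) E_r and (1 - p) E_1 are approximated by alternating sums over the
j prime to p, and the two sums differ by the terms (-1)^j j (j^(r-1) - 1). *)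
Lemma euler_num_stab a (r := weight_seq a) :
  abs ((1 - p%:R ^+ r) * euler_num r - (1 - p%:R) * euler_num 1)
    <= (p%:R ^+ a.+1)^-1.
Proof.
pose M := (p ^ a.+1)%N.
have oM : odd M by rewrite oddX p_odd orbT.
have absM : abs M%:R = (p%:R ^+ a.+1)^-1 by rewrite natrX padic_abs_pX.
have le_pM N m : odd N -> abs N%:R <= (p%:R ^+ a.+1)^-1 ->
    abs (euler_num m - altsum m N) <= (p%:R ^+ a.+1)^-1.
  by move=> oN; apply: le_trans; rewrite -padic_absN opprB altsum_euler_num.
have approx m : abs ((1 - p%:R ^+ m) * euler_num m
    - (altsum m (p * M) - p%:R ^+ m * altsum m M)) <= (p%:R ^+ a.+1)^-1.
  rewrite [X in abs X](_ : _ = (euler_num m - altsum m (p * M))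
    - p%:R ^+ m * (euler_num m - altsum m M)); last by ring.
  apply: padic_abs_ultra.
    apply: le_pM; first by rewrite oddM p_odd.
    rewrite natrM padic_absM absM ler_piMl ?padic_abs_nat //.
    by rewrite invr_ge0 exprn_ge0.
  rewrite padic_absN padic_absM (le_trans _ (le_pM M m oM _)) ?absM //.
  by rewrite ler_piMl ?padic_abs_ge0 // -natrX padic_abs_nat.
pose D m := altsum m (p * M) - p%:R ^+ m * altsum m M.
rewrite [X in abs X](_ : _ = ((1 - p%:R ^+ r) * euler_num r - D r)
   - ((1 - p%:R ^+ 1) * euler_num 1 - D 1%N) + (D r - D 1%N)); last first.
  by rewrite expr1; ring.
apply: padic_abs_ultra.
  by apply: padic_abs_ultra; rewrite ?padic_absN; apply: approx.
rewrite /D !altsum_stab -sumrB.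
apply: padic_abs_sum => [|j pj]; first by rewrite invr_ge0 exprn_ge0.
rewrite -mulrBr padic_abs_sign.
have rE : r = (weight_seq a).-1.+1 by rewrite prednK // /weight_seq add1n.
rewrite rE exprS expr1 -[X in _ - X]mulr1 -mulrBr padic_absM.
apply: (@le_trans _ _ (abs (j%:R ^+ (weight_seq a).-1 - 1))).
  by rewrite ler_piMl ?padic_abs_ge0 ?padic_abs_nat.
have := padic_abs_dvd (expn_weight_seq a j).
by rewrite coprime_sym prime_coprime // pj rmorphB /= -!pmulrn natrX.
Qed.

Lemma eventually_pX_lt (e : rat) : 0 < e ->
  exists A, forall a, (A <= a)%N -> (p%:R ^+ a.+1)^-1 < e.
Proof.
move=> e0; exists (Num.bound e^-1) => a Aa.
rewrite invf_plt ?posrE ?exprn_gt0 ?ltr0n ?prime_gt0 //.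
have e0' : 0 <= e^-1 by rewrite invr_ge0 ltW.
apply: lt_le_trans (archi_boundP e0') _; rewrite -natrX ler_nat.
exact: leq_trans (leq_trans Aa (leqnSn a)) (ltnW (ltn_expl _ (prime_gt1 p_pr))).
Qed.

Lemma bernoulli2 : bernoulli 2 = 6^-1.
Proof. by rewrite /bernoulli /= !big_ord_recr !big_ord0 /=. Qed.

(** With X = (1 - p^r) B_{r+1} / (r+1), whose expected limit is (1 - p) / 12, the
identity 2 (1 - 2^(r+1)) (X - (1 - p) / 12) = d + (2^(r+1) - 4) (1 - p) / 6 holds,
where d is the difference bounded in [euler_num_stab] and 2^(r+1) - 4 is small.
For large a the left factor has absolute value |3|, so p = 3 only costs one power
of p. *)
Lemma bernoulli_stab_cvg (e : rat) : 0 < e -> exists A, forall a, (A <= a)%N ->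
  abs ((1 - p%:R ^+ weight_seq a)
       * (bernoulli (weight_seq a).+1 / (weight_seq a).+1%:R)
     - (1 - p%:R) / 12) < e.
Proof.
move=> e0; have abs_n0 n : (0 < n)%N -> 0 < abs n%:R.
  by move=> n0; rewrite padic_abs_gt0 // pnatr_eq0 -lt0n.
have a3 := abs_n0 3 isT; have a6 := abs_n0 6 isT.
have [A hA] := eventually_pX_lt (mulr_gt0 e0 (mulr_gt0 a3 a6)).
have [A' hA'] := eventually_pX_lt a3.
exists (maxn A A') => a; rewrite geq_max => /andP[/hA {}hA /hA' {}hA'].
set r := weight_seq a.
set X := (1 - _) * _; set P := (p%:R ^+ a.+1)^-1 in hA hA'.
have P0 : 0 <= P by rewrite invr_ge0 exprn_ge0.
have d2 : abs (2 ^+ r.+1 - 4) <= P.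
  have -> : 2 ^+ r.+1 - 4 = 4 * (2 ^+ (weight_seq a).-1 - 1) :> rat.
    by rewrite /r /weight_seq add1n /= !exprS; ring.
  rewrite padic_absM; apply: (@le_trans _ _ (abs (2 ^+ (weight_seq a).-1 - 1))).
    by rewrite ler_piMl ?padic_abs_ge0 ?padic_abs_nat.
  have := padic_abs_dvd (expn_weight_seq a 2).
  by rewrite coprime2n p_odd rmorphB /= -!pmulrn natrX.
have abs3 : abs (1 - 2 ^+ r.+1) = abs 3.
  rewrite [X in abs X](_ : _ = - (3 + (2 ^+ r.+1 - 4))); last by ring.
  by rewrite padic_absN padic_abs_isosceles // (le_lt_trans d2).
pose d := (1 - p%:R ^+ r) * euler_num r - (1 - p%:R) * euler_num 1.
have h : abs d <= P by exact: euler_num_stab.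
have e1 : 2 * (1 - 2 ^+ r.+1) * (X - (1 - p%:R) / 12) =
    d + (2 ^+ r.+1 - 4) * ((1 - p%:R) / 6).
  rewrite /d /X /euler_num bernoulli2.
  by move: (bernoulli r.+1 / _) => b; field.
have : abs (2 * (1 - 2 ^+ r.+1) * (X - (1 - p%:R) / 12)) <= P / abs 6.
  have P6 : P <= P / abs 6.
    by rewrite ler_pdivlMr // ler_piMr // padic_abs_nat.
  rewrite e1; apply: padic_abs_ultra; first exact: le_trans h P6.
  rewrite padic_absM ler_pM ?padic_abs_ge0 // padic_absM padic_absV.
  rewrite ler_piMl ?invr_ge0 ?padic_abs_ge0 //.
  by have := padic_abs_int p_pr (1 - p%:Z); rewrite rmorphB /= -pmulrn.
rewrite !padic_absM padic_abs2 mul1r abs3 -ler_pdivlMl // => /le_lt_trans; apply.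
by rewrite mulrC ltr_pdivrMr // ltr_pdivrMr // -mulrA.
Qed.

End AlternatingSums.

(** * Newton coefficients *)

Section NewtonCoefficients.

Lemma sign_addn_subn (m j : nat) : (j <= m)%N ->
  (-1) ^+ (m + j) = (-1) ^+ (m - j) :> int.
Proof. by move=> jm; rewrite -signr_odd -[RHS]signr_odd oddD oddB. Qed.

Lemma coef_c1 m : coef_c 1 m = (m == 0%N).
Proof.
rewrite [RHS](_ : _ = (1 - 1 : int) ^+ m); last by rewrite subrr expr0n natz.
rewrite addrC exprDn; apply: eq_bigr => j _.
have jm : (j <= m)%N by rewrite -ltnS.
by rewrite expn0 expr1n mulr1 muln1 sign_addn_subn // -mulr_natr natz.
Qed.

(** From (j+1) C(m, j) = (m+1) C(m, j) - m C(m-1, j). *)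
Lemma coef_cS r m :
  coef_c r.+2 m = m.+1%:Z * coef_c r.+1 m + m%:Z * coef_c r.+1 m.-1.
Proof.
have widen : m%:Z * coef_c r.+1 m.-1 =
    \sum_(j < m.+1) (-1) ^+ (m + j).+1 * ((m - j) * 'C(m, j) * j.+1 ^ r)%N%:Z.
  case: m => [|m]; first by rewrite mul0r big_ord1 subnn !mul0n mulr0.
  rewrite big_ord_recr /= subnn !mul0n mulr0 addr0 mulr_sumr.
  apply: eq_bigr => j _; rewrite mulrCA -PoszM mulnA -mul_bin_down.
  by rewrite addSn !exprS !mulN1r opprK.
rewrite widen mulr_sumr -big_split; apply: eq_bigr => j _ /=.
have jm : (j <= m)%N by rewrite -ltnS.
rewrite mulrCA exprS mulN1r mulNr -mulrBr; congr (_ * _).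
move: (nat_of_ord j) jm => {}j jm.
have [k ->] : exists k, m = (k + j)%N by exists (m - j)%N; rewrite subnK.
rewrite addnK expnS !PoszM -addnS PoszD; ring.
Qed.

Lemma coef_c_eq0 r m : (r < m)%N -> coef_c r.+1 m = 0.
Proof.
elim: r m => [|r IH] m rm; first by rewrite coef_c1 gtn_eqF.
rewrite coef_cS !IH ?mulr0 ?addr0 // ?(ltnW rm) //.
by case: m rm.
Qed.

(** Newton's expansion of (x+1)^r. The hypothesis on [beta] is the recurrence of
the binomial coefficients binom(x, m), so that x can be a negative integer. *)
Lemma coef_c_eval (R : comNzRingType) (x : R) (beta : nat -> R) r :
  beta 0%N = 1 ->
  (forall m, m.+1%:R * beta m.+1 = (x - m%:R) * beta m) ->
  \sum_(m < r.+1) (coef_c r.+1 m)%:~R * beta m = (x + 1) ^+ r.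
Proof.
move=> beta0 betaS; elim: r => [|r IH].
  by rewrite big_ord1 coef_c1 beta0 mulr1.
rewrite exprS -IH mulr_sumr.
under eq_bigr => m _ do rewrite coef_cS intrD !intrM mulrDl.
rewrite big_split /=.
rewrite big_ord_recr /= coef_c_eq0 // mulr0 mul0r addr0.
rewrite [X in _ + X]big_ord_recl /= !mul0r add0r -big_split.
apply: eq_bigr => m _ /=; rewrite /bump /= add1n add0n.
rewrite -!pmulrn.
have -> : m.+1%:R * (coef_c r.+1 m)%:~R * beta m.+1 =
  (coef_c r.+1 m)%:~R * (m.+1%:R * beta m.+1) by ring.
rewrite betaS -natr1; ring.
Qed.

Lemma coef_c_pos (R : comNzRingType) r j :
  \sum_(m < r.+1) (coef_c r.+1 m)%:~R * 'C(j, m)%:R = j.+1%:R ^+ r :> R.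
Proof.
rewrite -natr1; apply: (@coef_c_eval R _ (fun m => 'C(j, m)%:R)) => [|m].
  by rewrite bin0.
have [mj|jm] := leqP m j; last by rewrite !bin_small ?mulr0 // ltnW.
by rewrite -natrM mul_bin_left natrM natrB.
Qed.

Lemma coef_c_neg (R : comNzRingType) r j :
  \sum_(m < r.+1) (coef_c r.+1 m)%:~R * ((-1) ^+ m * 'C(m + j, m)%:R)
    = (- j%:R) ^+ r :> R.
Proof.
rewrite [X in X ^+ _](_ : _ = - j.+1%:R + 1); last by rewrite -natr1; ring.
apply: (@coef_c_eval R _ (fun m => (-1) ^+ m * 'C(m + j, m)%:R)) => [|m].
  by rewrite bin0 mulr1.
have e : (m.+1 * 'C(m.+1 + j, m.+1) = (m + j).+1 * 'C(m + j, m))%N.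
  by rewrite addSn mul_bin_diag.
rewrite exprS mulrCA -natrM e natrM -natr1 natrD -natr1; ring.
Qed.

End NewtonCoefficients.

Section NewtonLimit.

Variables (p : nat) (p_pr : prime p).

(** The limit of c(r, m): the terms (j+1)^(r-1) tend to 1 or 0. *)
Definition coef_c_lim (m : nat) : int :=
  \sum_(j < m.+1) (-1) ^+ (m + j) * ('C(m, j) * coprime j.+1 p)%N%:Z.

Lemma coef_c_lim_dvd a m :
  ((p ^ a.+1)%N%:Z %| coef_c (weight_seq p a) m - coef_c_lim m)%Z.
Proof.
rewrite -sumrB; apply: (big_ind (fun z => (p ^ a.+1)%N%:Z %| z)%Z) => [|x y|j _].
- exact: dvdz0.
- exact: rpredD.
rewrite -mulrBr; apply: dvdz_mull.
by rewrite !PoszM -mulrBr; apply: dvdz_mull; exact: expn_weight_seq.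
Qed.

End NewtonLimit.

Local Open Scope classical_set_scope.

(** * Zero modes of the states *)

Section FiniteSupport.

Lemma fsum_ord (V : nmodType) (F : nat -> V) N :
  (forall i, (N <= i)%N -> F i = 0) ->
  \sum_(i \in [set: nat]) F i = \sum_(i < N) F i.
Proof.
move=> F0; rewrite -(big_mkord xpredT F).
rewrite -(@fsbig_fwiden _ _ _ _ (index_iota 0 N) [set i | (i < N)%N]).
- apply/esym/fsbig_widen => // i [_ /= /negP]; rewrite -leqNgt; exact: F0.
- by move=> i /=; rewrite mem_index_iota.
- exact: iota_uniq.
- by move=> i [/=]; rewrite mem_index_iota /= => ->.
Qed.

Lemma fsum_one (V : nmodType) (F : nat -> V) k :
  (forall i, i != k -> F i = 0) -> \sum_(i \in [set: nat]) F i = F k.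
Proof.
move=> F0; rewrite (@fsum_ord _ _ k.+1) => [|i ki]; last first.
  by apply: F0; rewrite gtn_eqF.
rewrite big_ord_recr /= big1 ?add0r // => i _.
by apply: F0; rewrite ltn_eqF.
Qed.

Lemma fsum_eq0 (V : nmodType) (F : nat -> V) :
  (forall i, F i = 0) -> \sum_(i \in [set: nat]) F i = 0.
Proof. by move=> F0; rewrite (@fsum_ord _ _ 0%N) ?big_ord0. Qed.

End FiniteSupport.

Section Weights.
Implicit Types m : {cmonom nat}.

Lemma wtEw (D : {fset nat}) m : (finsupp m `<=` D)%fset ->
  wt m = (\sum_(i <- D) m i * i.+1)%N.
Proof.
move=> mD; apply: big_fset_incl => // i _; rewrite -cmE_eq0 => /eqP ->.
by rewrite mul0n.
Qed.

Lemma wtM m1 m2 : wt (mmul m1 m2) = (wt m1 + wt m2)%N.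
Proof.
pose D := (finsupp m1 `|` finsupp m2)%fset.
rewrite (@wtEw D m1) ?fsubsetUl // (@wtEw D m2) ?fsubsetUr //.
rewrite (@wtEw D) ?mdomD // -big_split; apply: eq_bigr => i _.
by rewrite cmM mulnDl.
Qed.

Lemma wt_ucm j : wt (ucm j) = j.+1.
Proof. by rewrite /wt mdomU big_seq_fset1 cmUU mul1n. Qed.

End Weights.

(** The monomial h_{-k-1} h_{-1}. *)
Definition mon2 (k : nat) : {cmonom nat} := mmul (ucm k) (ucm 0%N).

Lemma wt_mon2 k : wt (mon2 k) = k.+2.
Proof. by rewrite wtM !wt_ucm addn1. Qed.

Lemma word_mon2 k : word (mon2 k) = [:: 0%N; k].
Proof.
have mE i : mon2 k i = ((k == i) + (0%N == i))%N by rewrite cmM !cmU.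
have supp : finsupp (mon2 k) = [fset k; 0%N]%fset by rewrite mdomD !mdomU.
have [k0|k0] := eqVneq k 0%N.
  rewrite /word (_ : sort leq _ = [:: 0%N]); last first.
    rewrite supp k0; apply: (sorted_eq leq_trans anti_leq) => //.
      by apply: sort_sorted; exact: leq_total.
    rewrite perm_sort; apply: uniq_perm; rewrite ?fset_uniq // => i.
    by rewrite !inE orbb.
  by rewrite /= mE k0.
rewrite /word (_ : sort leq _ = [:: 0%N; k]); last first.
  apply: (sorted_eq leq_trans anti_leq) => //.
    by apply: sort_sorted; exact: leq_total.
  rewrite perm_sort supp; apply: uniq_perm; rewrite ?fset_uniq //.
    by rewrite /= inE eq_sym k0.
  by move=> i; rewrite !inE orbC.
by rewrite /= !mE !eqxx (negPf k0) eq_sym (negPf k0).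
Qed.

Section VertexOperators.

Variables (p : nat) (p_pr : prime p).
Local Notation K := (Qp p_pr).
Local Notation Fock := (Fock p_pr).
Implicit Types (m : {cmonom nat}) (x : Fock).

(** A basis vector with [Fock] as its syntactic type: unification between the
algebra structures of [Fock] and of the underlying type is costly. *)
Definition mono m : Fock := << m >>.

Lemma heis0 x : heis 0%N x = 0.
Proof. by apply: big1_seq => m _; rewrite mul0n mulr0 scale0r. Qed.

Lemma heis_posS j m : heis j.+1%:Z (mono m) =
  (j.+1 * m j)%:R *: mono (divcm m (ucm j)).
Proof. by rewrite /heis msuppU1 big_seq_fset1 mcoeffUU mul1r. Qed.

Lemma mono_mul (m1 m2 : {cmonom nat}) :
  mono m1 * mono m2 = mono (mmul m1 m2).
Proof. by rewrite malgM_def fgmulUU mulr1. Qed.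

Lemma mulcm_divcm m j : m j != 0%N -> mmul (ucm j) (divcm m (ucm j)) = m.
Proof.
move=> mj; apply/eqP/cmP => i; rewrite mulcmE divcmE ucmE.
by have [<-|] := eqVneq j i; rewrite ?subn0 // subnKC // lt0n.
Qed.

Lemma heis_negE j x : heis (Negz j) x = mono (ucm j) * x.
Proof. by []. Qed.

Lemma mulFockZ (a : K) (x y : Fock) : x * (a *: y) = a *: (x * y).
Proof. by rewrite scalerAr. Qed.

(** h(-j-1) h(j+1) is (j+1) times the Euler operator of the variable h_{-j-1}. *)
Lemma heis_neg_pos j m : heis (Negz j) (heis j.+1%:Z (mono m)) =
  (j.+1 * m j)%:R *: mono m.
Proof.
rewrite heis_posS heis_negE mulFockZ mono_mul.
have [/eqP mj|mj] := boolP (m j == 0%N).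
  by rewrite mj muln0 [LHS]scale0r [RHS]scale0r.
by rewrite mulcm_divcm.
Qed.

(** (-1)^k binom(n, k) for an integer n: the mode n of the k-th divided derivative
of the field h(z) is this multiple of h(n - k). *)
Definition mode1_coef (k : nat) (n : int) : K :=
  match n with
  | Posz n => (-1) ^+ k * 'C(n, k)%:R
  | Negz n => 'C(k + n, k)%:R
  end.

Lemma heis_neg0 j : heis (Negz j) (0 : Fock) = 0.
Proof. by rewrite heis_negE mulr0. Qed.

Lemma mode1_term_eq0 k n x (i : nat) (F := if n + i%:Z == -1 then x else 0)
    (G := if n - k.+1%:Z - i%:Z == -1 then heis i%:Z x else 0) :
  n + i%:Z != -1 -> n - k.+1%:Z - i%:Z != -1 ->
  'C(k + i, i)%:R *: (heis (Negz (k + i)) F + (-1) ^+ k *: G) = 0 :> Fock.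
Proof.
rewrite /F /G => /negPf -> /negPf ->.
by rewrite heis_neg0 scaler0 addr0 scaler0.
Qed.

Lemma mode1_single k n x j :
  (forall i : nat, i != j -> n + i%:Z != -1 /\ n - k.+1%:Z - i%:Z != -1) ->
  mode [:: k] n x = 'C(k + j, j)%:R *:
    (heis (Negz (k + j)) (if n + j%:Z == -1 then x else 0)
     + (-1) ^+ k *: (if n - k.+1%:Z - j%:Z == -1 then heis j%:Z x else 0)).
Proof.
by move=> h; apply: (fsum_one (k := j)) => i /h[]; exact: mode1_term_eq0.
Qed.

Lemma mode1E k n x : mode [:: k] n x = mode1_coef k n *: heis (n - k%:Z) x.
Proof.
case: n => n.
  have E (i : nat) : n%:Z + i%:Z != -1 by [].
  have [kn|nk] := leqP k n; last first.
    rewrite [RHS](_ : _ = 0); last by rewrite /mode1_coef bin_small // mulr0 scale0r.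
    by apply: fsum_eq0 => i; apply: mode1_term_eq0 => //; lia.
  rewrite (@mode1_single _ _ _ (n - k)%N) => [|i ink]; last by split => //; lia.
  rewrite (negPf (E _)) heis_neg0 add0r.
  have -> : (n%:Z - k.+1%:Z - (n - k)%N%:Z == -1) by lia.
  have -> : n%:Z - k%:Z = (n - k)%N%:Z by lia.
  by rewrite (subnKC kn) (bin_sub kn) scalerA mulrC.
have E (i : nat) : Negz n - k.+1%:Z - i%:Z != -1 by lia.
rewrite (@mode1_single _ _ _ n) => [|i ni]; last by split => //; lia.
rewrite (negPf (E _)) scaler0 addr0.
have -> : Negz n + n%:Z == -1 by lia.
have -> : Negz n - k%:Z = Negz (k + n) by lia.
by rewrite -[X in 'C(_, X)](addKn k n) bin_sub // leq_addr.
Qed.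

(** The two kinds of modes of h(-k-1)1 that occur in the zero mode of
h(-k-1)h(-1)1. *)
Lemma mode1_pos k i x :
  mode [:: k] (k.+1%:Z + i%:Z) x =
  ((-1) ^+ k * 'C(k + i.+1, k)%:R) *: heis i.+1%:Z x.
Proof.
have -> : k.+1%:Z + i%:Z = (k + i.+1)%N%:Z by lia.
by rewrite mode1E; have -> : (k + i.+1)%N%:Z - k%:Z = i.+1%:Z by lia.
Qed.

Lemma mode1_neg k j x :
  mode [:: k] (k.+1%:Z - 1%:Z - j.+1%:Z) x = 'C(j, k)%:R *: heis (Negz j) x.
Proof.
rewrite mode1E; have -> : k.+1%:Z - 1%:Z - j.+1%:Z - k%:Z = Negz j by lia.
apply: (congr1 (fun a : K => a *: heis (Negz j) x)); have [kj|jk] := leqP k j.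
  have -> : k.+1%:Z - 1%:Z - j.+1%:Z = Negz (j - k) by lia.
  by rewrite /mode1_coef subnKC.
have -> : k.+1%:Z - 1%:Z - j.+1%:Z = (k - j.+1)%N%:Z by lia.
rewrite /mode1_coef [in RHS]bin_small // bin_small ?mulr0 //; lia.
Qed.

Lemma mode2_term k m i :
  'C(0 + i, i)%:R *: (heis (Negz (0 + i)) (mode [:: k] (k.+1%:Z + i%:Z) (mono m))
     + (-1) ^+ 0 *: mode [:: k] (k.+1%:Z - 1%:Z - i%:Z) (heis i%:Z (mono m)))
  = ((-1) ^+ k * 'C(k + i.+1, k)%:R * (i.+1 * m i)%:R
     + (if i is j.+1 then 'C(j, k)%:R * (j.+1 * m j)%:R else 0)) *: mono m.
Proof.
rewrite add0n binn scale1r expr0 scale1r scalerDl; apply: (congr2 +%R).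
  by rewrite mode1_pos -[RHS]scalerA -heis_neg_pos !heis_negE mulFockZ.
case: i => [|j]; last by rewrite mode1_neg heis_neg_pos scalerA.
rewrite heis0 mode1E scale0r.
have -> : k.+1%:Z - 1%:Z - 0%N%:Z - k%:Z = 0%N%:Z by lia.
by rewrite heis0 scaler0.
Qed.

(** In the iterate formula h(-j-1) h(j+1) occurs twice: in the first summand at
index j and in the second at index j + 1. The second summand at index 0 contains
h(0) = 0. *)
Lemma mode2E k m J : (forall j, (J <= j)%N -> m j = 0%N) ->
  mode [:: 0%N; k] k.+1%:Z (mono m) =
  (\sum_(j < J) ((-1) ^+ k * 'C(k + j.+1, k)%:R + 'C(j, k)%:R)
     * (j.+1 * m j)%:R) *: mono m.
Proof.
move=> mJ; have mJ0 j : (J <= j)%N -> (j.+1 * m j)%:R = 0 :> K.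
  by move=> /mJ ->; rewrite muln0.
pose A j : K := (-1) ^+ k * 'C(k + j.+1, k)%:R * (j.+1 * m j)%:R.
pose B j : K := 'C(j, k)%:R * (j.+1 * m j)%:R.
rewrite [LHS](_ : _ =
    \sum_(i \in [set: nat]) (A i + (if i is j.+1 then B j else 0)) *: mono m).
  rewrite (@fsum_ord _ _ J.+1) => [|[//|i]]; last first.
    by move=> Ji; rewrite /A /B !mJ0 ?mulr0 ?addr0 ?scale0r // ltnW.
  rewrite -scaler_suml; apply: (congr1 (fun a : K => a *: mono m)).
  rewrite big_split /= big_ord_recr /= {2}/A mJ0 // mulr0 addr0.
  rewrite [X in _ + X]big_ord_recl /= add0r -big_split.
  by apply: eq_bigr => j _; rewrite [RHS]mulrDl.
by apply: eq_fsbigr => i _; exact: mode2_term.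
Qed.

Lemma zero_modeEw (D : {fset {cmonom nat}}) (v x : Fock) : (msupp v `<=` D)%fset ->
  zero_mode v x = \sum_(m <- D) v@_m *: mode (word m) ((wt m)%:Z - 1) x.
Proof.
move=> vD; apply: big_fset_incl => // m _ /mcoeff_outdom ->.
by rewrite scale0r.
Qed.

Lemma zero_mode_linear a (u v x : Fock) :
  zero_mode (a *: u + v) x = a *: zero_mode u x + zero_mode v x.
Proof.
pose D := (msupp u `|` msupp v)%fset.
have uD : (msupp u `<=` D)%fset by exact: fsubsetUl.
have vD : (msupp v `<=` D)%fset by exact: fsubsetUr.
have wD : (msupp (a *: u + v) `<=` D)%fset.
  apply: fsubset_trans (msuppD_le _ _) _.
  by apply: fsetSU; exact: msuppZ_le.
rewrite (zero_modeEw _ uD) (zero_modeEw _ vD) (zero_modeEw _ wD).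
rewrite scaler_sumr -big_split; apply: eq_bigr => m _.
by rewrite mcoeffD mcoeffZ scalerDl scalerA.
Qed.

Lemma zero_modeZ a (u x : Fock) : zero_mode (a *: u) x = a *: zero_mode u x.
Proof.
have z : zero_mode (0 : Fock) x = 0 by rewrite /zero_mode msupp0 big_seq_fset0.
by rewrite -[a *: u]addr0 zero_mode_linear z addr0.
Qed.

Lemma zero_mode_sum (I : Type) (s : seq I) (F : I -> Fock) x :
  zero_mode (\sum_(i <- s) F i) x = \sum_(i <- s) zero_mode (F i) x.
Proof.
elim: s => [|i s IH]; first by rewrite !big_nil /zero_mode msupp0 big_seq_fset0.
by rewrite !big_cons -[F i]scale1r zero_mode_linear IH !scale1r.
Qed.

Lemma zero_mode1 x : zero_mode 1 x = x.
Proof.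
have -> : (1 : Fock) = mono mone by [].
rewrite /zero_mode msuppU1 big_seq_fset1 mcoeffUU scale1r.
by rewrite /word /wt mdom1 /= big_seq_fset0.
Qed.

Lemma heis_heis1 k : heis (Negz k) (heis (Negz 0) (1 : Fock)) = mono (mon2 k).
Proof.
rewrite heis_negE heis_negE /mon2 -mono_mul.
exact: (congr1 (fun x => mono (ucm k) * x) (mulr1 (mono (ucm 0%N)))).
Qed.

Lemma zero_mode_heis_heis k m J : (forall j, (J <= j)%N -> m j = 0%N) ->
  zero_mode (heis (Negz k) (heis (Negz 0) (1 : Fock))) (mono m) =
  (\sum_(j < J) ((-1) ^+ k * 'C(k + j.+1, k)%:R + 'C(j, k)%:R)
     * (j.+1 * m j)%:R) *: mono m.
Proof.
move=> mJ; rewrite heis_heis1 /zero_mode msuppU1 big_seq_fset1 mcoeffUU scale1r.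
rewrite word_mon2 wt_mon2 -mode2E //; congr mode.
Qed.

(** Summing [zero_mode_heis_heis] against c(r, k), the two Newton expansions give
(-(j+1))^(r-1) and (j+1)^(r-1), which are equal because r is odd. *)
Lemma zero_mode_state_u r m J : odd r -> (forall j, (J <= j)%N -> m j = 0%N) ->
  zero_mode (state_u p_pr r) (mono m) =
  ((1 - p%:R ^+ r) * (2 * \sum_(j < J) j.+1%:R ^+ r * (m j)%:R
     - ratr (bernoulli r.+1 / r.+1%:R))) *: mono m.
Proof.
case: r => // r; rewrite oddS => er mJ; rewrite /state_u zero_modeZ -scalerA.
congr (_ *: _).
rewrite addrC -scaleNr zero_mode_linear zero_mode1 zero_mode_sum addrC scalerBl.
rewrite scaleNr; congr (_ - _).
under eq_bigr do rewrite zero_modeZ (zero_mode_heis_heis _ mJ) scalerA.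
rewrite -scaler_suml; apply: (congr1 (fun a : K => a *: mono m)).
under eq_bigr do rewrite mulr_sumr.
rewrite exchange_big mulr_sumr; apply: eq_bigr => j _ /=.
under eq_bigr do rewrite mulrA mulrDr.
rewrite -mulr_suml big_split /= coef_c_neg coef_c_pos.
rewrite exprNn -signr_odd (negPf er) expr0 mul1r natrM exprS; ring.
Qed.

End VertexOperators.

(** * Partitions and the normalized character *)

Section WeightSets.
Implicit Types m : {cmonom nat}.

Lemma cm_ext (m1 m2 : {cmonom nat}) : (forall i, m1 i = m2 i) -> m1 = m2.
Proof. by move=> h; apply/eqP/cmP. Qed.

Lemma ltn_wt m j : m j != 0%N -> (j < wt m)%N.
Proof. by move=> mj; rewrite -(mulcm_divcm mj) wtM wt_ucm leq_addr. Qed.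

Lemma wt_coef0 m j : (wt m <= j)%N -> m j = 0%N.
Proof. by apply: contraTeq => /ltn_wt; rewrite -ltnNge. Qed.

Lemma wt_eq0 m : wt m = 0%N -> m = mone.
Proof. by move=> m0; refine (@cm_ext _ _ _) => i; rewrite cm1 wt_coef0 ?m0. Qed.

Lemma wt1 : wt (mone : {cmonom nat}) = 0%N.
Proof. by rewrite /wt mdom1 big_seq_fset0. Qed.

(** A monomial other than 1 is a variable times a monomial of smaller weight. *)
Lemma finite_wt n : finite_set [set m | wt m = n].
Proof.
elim/ltn_ind: n => n IH.
apply: (sub_finite_set (B := [set mone] `|` \bigcup_(j in [set j | (j < n)%N])
  (mmul (ucm j) @` [set m | wt m = (n - j.+1)%N]))).
  move=> m /= mn; have [->|m1] := eqVneq m mone; [by left|right].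
  have [j jn mj] : exists2 j, (j < n)%N & m j != 0%N.
    apply: contrapT => h; move/eqP: m1; apply; refine (@cm_ext _ _ _) => i.
    rewrite cm1; apply/eqP; apply: contraT => mi; case: h; exists i => //.
    by rewrite -mn ltn_wt.
  exists j => //=; exists (divcm m (ucm j)); last exact: mulcm_divcm.
  by rewrite -mn -{2}(mulcm_divcm mj) wtM wt_ucm addKn.
rewrite finite_setU; split; first exact: finite_set1.
apply: bigcup_finite; first exact: finite_II.
move=> j /= jn; apply: finite_image; apply: IH.
by rewrite ltn_subrL (leq_ltn_trans _ jn).
Qed.

Definition wtset n : {fset {cmonom nat}} := fset_set [set m | wt m = n].

Lemma mem_wtset n m : (m \in wtset n) = (wt m == n).
Proof.
rewrite in_fset_set; last exact: finite_wt.
by apply/idP/eqP => [|h]; rewrite inE.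
Qed.

Lemma mulcmI j : injective (mmul (ucm j) : {cmonom nat} -> {cmonom nat}).
Proof.
move=> m1 m2 /eqP/cmP e; refine (@cm_ext _ _ _) => i.
by have := e i; rewrite !cmM => /addnI.
Qed.

(** Multiplication by a variable is a bijection onto the monomials that contain
it. *)
Lemma wtset_mul n j : (j < n)%N ->
  perm_eq [seq m : {cmonom nat} <- wtset n | m j != 0%N]
          [seq mmul (ucm j) m | m <- wtset (n - j.+1)].
Proof.
move=> jn; apply: uniq_perm.
- by rewrite filter_uniq ?fset_uniq.
- by rewrite (map_inj_uniq (@mulcmI j)) fset_uniq.
move=> m; rewrite mem_filter mem_wtset; apply/andP/mapP => [[mj /eqP mn]|[m']].
  exists (divcm m (ucm j)); last by rewrite mulcm_divcm.
  by rewrite mem_wtset -mn -{2}(mulcm_divcm mj) wtM wt_ucm addKn.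
rewrite mem_wtset => /eqP m'n ->; rewrite cmM cmUU wtM wt_ucm m'n.
by rewrite subnKC.
Qed.

End WeightSets.

Section PartitionSeries.

Variables (p : nat) (p_pr : prime p).
Local Notation K := (Qp p_pr).
Local Notation euler := (euler_prod p_pr).
Implicit Types (e g : nat -> K).

(** Multiplication by q^l. *)
Definition qshift (l : nat) g : nat -> K := fun n =>
  if (n < l)%N then 0 else g (n - l)%N.

Lemma qmulC e g n : qmul e g n = qmul g e n :> K.
Proof.
rewrite /qmul (reindex_inj rev_ord_inj); apply: eq_bigr => i _ /=.
by rewrite subSS subKn -1?ltnS // mulrC.
Qed.

Lemma qmul_shiftr l e g n : qmul e (qshift l g) n = qshift l (qmul e g) n :> K.
Proof.
rewrite /qmul /qshift; case: ltnP => [nl|ln].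
  by apply: big1 => i _; rewrite (leq_ltn_trans (leq_subr _ _) nl) mulr0.
rewrite -(big_mkord xpredT (fun i =>
  e i * (if (n - i < l)%N then 0 else g (n - i - l)%N))).
rewrite (@big_cat_nat _ _ _ (n - l).+1) //=; last by rewrite ltnS leq_subr.
rewrite [X in _ + X]big_nat_cond [X in _ + X]big1 ?addr0; last first.
  move=> i /andP[/andP[li ni] _]; case: ltnP => [|lni]; first by rewrite mulr0.
  exfalso; lia.
rewrite big_mkord; apply: eq_bigr => i _.
have il : (i <= n - l)%N by rewrite -ltnS.
case: ltnP => [nil|_]; first by exfalso; lia.
by congr (_ * g _); lia.
Qed.

Lemma qmul_shiftl l e g n : qmul (qshift l e) g n = qshift l (qmul e g) n :> K.
Proof.
rewrite qmulC qmul_shiftr /qshift; case: ltnP => // _; exact: qmulC.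
Qed.

Lemma eq_qmul e e' g g' n : (forall i, (i <= n)%N -> e i = e' i) ->
  (forall i, (i <= n)%N -> g i = g' i) -> qmul e g n = qmul e' g' n :> K.
Proof.
move=> ee gg; apply: eq_bigr => i _.
by rewrite ee -1?ltnS // gg // leq_subr.
Qed.

Lemma qmulDr e g g' n :
  qmul e (fun i => g i + g' i) n = qmul e g n + qmul e g' n :> K.
Proof. by rewrite -big_split; apply: eq_bigr => i _; rewrite mulrDr. Qed.

Lemma qmulBr e g g' n :
  qmul e (fun i => g i - g' i) n = qmul e g n - qmul e g' n :> K.
Proof. by rewrite -sumrB; apply: eq_bigr => i _; rewrite mulrBr. Qed.

Lemma qmulBl e e' g n :
  qmul (fun i => e i - e' i) g n = qmul e g n - qmul e' g n :> K.
Proof. by rewrite -sumrB; apply: eq_bigr => i _; rewrite mulrBl. Qed.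

Lemma qmulZr e g c n : qmul e (fun i => c * g i) n = c * qmul e g n :> K.
Proof. by rewrite mulr_sumr; apply: eq_bigr => i _; rewrite mulrCA. Qed.

Lemma qmul_sumr (I : Type) (s : seq I) e (g : I -> nat -> K) n :
  qmul e (fun i => \sum_(j <- s) g j i) n = \sum_(j <- s) qmul e (g j) n :> K.
Proof.
by rewrite exchange_big; apply: eq_bigr => i _; rewrite mulr_sumr.
Qed.

Definition weight_sum (F : {cmonom nat} -> K) n : K := \sum_(m <- wtset n) F m.

Lemma eq_weight_sum F G n :
  (forall m, wt m = n -> F m = G m) -> weight_sum F n = weight_sum G n.
Proof.
by move=> FG; apply: eq_big_seq => m; rewrite mem_wtset => /eqP/FG.
Qed.

Lemma weight_sum_shift F j n :
  weight_sum (fun m => if m j == 0%N then 0 else F m) n =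
  qshift j.+1 (weight_sum (fun m => F (mmul (ucm j) m))) n.
Proof.
rewrite /qshift ltnS; case: leqP => [nj|jn].
  apply: big1_seq => m /=; rewrite mem_wtset => /eqP mn.
  by rewrite wt_coef0 ?mn.
rewrite /weight_sum -[RHS](big_map (mmul (ucm j)) xpredT F).
rewrite -(perm_big _ (wtset_mul jn)) big_filter [RHS]big_mkcond.
by apply: eq_bigr => m _; case: eqP.
Qed.

Definition bounded N (m : {cmonom nat}) := `[< forall i, (N <= i)%N -> m i = 0%N >].

Definition npart_bounded N : nat -> K := weight_sum (fun m => (bounded N m)%:R).

(** The generating series of the partitions: monomials of weight n correspond to
partitions of n, and [npart_bounded] counts those with parts at most N. *)
Definition npart : nat -> K := weight_sum (fun _ => 1).

(** The partitions with parts at most N + 1 that do contain N + 1 are obtained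
uniquely by adding a part N + 1. *)
Lemma npart_boundedS N n :
  npart_bounded N n = npart_bounded N.+1 n - qshift N.+1 (npart_bounded N.+1) n.
Proof.
have bS m : bounded N.+1 (mmul (ucm N) m) = bounded N.+1 m.
  apply/asboolP/asboolP => h i Ni; have := h i Ni.
    by rewrite cmM cmU ltn_eqF.
  by rewrite cmM cmU ltn_eqF.
have -> : qshift N.+1 (npart_bounded N.+1) n =
    qshift N.+1 (weight_sum (fun m => (bounded N.+1 (mmul (ucm N) m))%:R)) n.
  by rewrite /qshift; case: ifP => // _; apply: eq_bigr => m _; rewrite bS.
rewrite -(weight_sum_shift (fun m => (bounded N.+1 m)%:R)) -sumrB.
apply: eq_bigr => m _; case: eqP => [mN|mN]; rewrite ?subr0 ?subrr.
  congr (_%:R); congr nat_of_bool; apply/asboolP/asboolP => h i.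
    by move=> Ni; apply: h; exact: ltnW.
  by rewrite leq_eqVlt => /predU1P[<-|/h].
by rewrite [bounded N m](_ : _ = false) //; apply/asboolPn => /(_ N (leqnn N)).
Qed.

Lemma npart_bounded0 n : npart_bounded 0 n = (n == 0%N)%:R.
Proof.
have b1 m : bounded 0 m -> m = mone.
  by move=> /asboolP h; refine (@cm_ext _ _ _) => i; rewrite cm1 h.
case: n => [|n] /=.
  rewrite /npart_bounded /weight_sum (_ : wtset 0 = [fset mone]%fset).
    rewrite big_seq_fset1 (_ : bounded 0 mone) //.
    by apply/asboolP => i _; rewrite cm1.
  apply/fsetP => m; rewrite mem_wtset in_fset1; apply/eqP/eqP => [/wt_eq0 //|->].
  exact: wt1.
apply: big1_seq => m /=; rewrite mem_wtset => /eqP mn.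
by case: (boolP (bounded 0 m)) => // /b1 mE; rewrite mE wt1 in mn.
Qed.

Lemma npart_bounded_eq N n : (n <= N)%N -> npart_bounded N n = npart n.
Proof.
move=> nN; apply: eq_weight_sum => m mn.
rewrite (_ : bounded N m) //; apply/asboolP => i Ni.
by rewrite wt_coef0 // mn (leq_trans nN).
Qed.

Definition euler_trunc N : nat -> K := fun n =>
  (\prod_(1 <= i < N.+1) (1 - 'X^i) : {poly K})`_n.

Lemma euler_truncS N n :
  euler_trunc N.+1 n = euler_trunc N n - qshift N.+1 (euler_trunc N) n.
Proof.
rewrite /euler_trunc big_nat_recr //= mulrBr mulr1 coefB coefMXn.
by rewrite /qshift.
Qed.

Lemma euler_trunc_eq N n : (n <= N)%N -> euler_trunc N n = euler n.
Proof.
elim: N => [|N IH]; first by rewrite leqn0 => /eqP ->.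
rewrite leq_eqVlt => /predU1P[-> //|nN].
by rewrite euler_truncS /qshift nN subr0 IH.
Qed.

(** The factor 1 - q^(N+1) removes the part N + 1 ([npart_boundedS]). *)
Lemma qmul_trunc N n :
  qmul (euler_trunc N) (npart_bounded N) n = (n == 0%N)%:R :> K.
Proof.
elim: N n => [|N IH] n.
  have e0 i : euler_trunc 0 i = (i == 0%N)%:R.
    by rewrite /euler_trunc big_geq // coef1.
  rewrite /qmul big_ord_recl big1 => [|i _]; last by rewrite e0 mul0r.
  by rewrite e0 mul1r addr0 subn0 npart_bounded0.
rewrite (@eq_qmul _ (fun i => euler_trunc N i - qshift N.+1 (euler_trunc N) i)
  _ (npart_bounded N.+1)) // => [|i _]; last exact: euler_truncS.
rewrite qmulBl qmul_shiftl -IH.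
rewrite [RHS](@eq_qmul _ (euler_trunc N)
  _ (fun i => npart_bounded N.+1 i - qshift N.+1 (npart_bounded N.+1) i)) //.
  by rewrite qmulBr qmul_shiftr.
by move=> i _; exact: npart_boundedS.
Qed.

Lemma euler_npart n : qmul euler npart n = (n == 0%N)%:R :> K.
Proof.
rewrite -(qmul_trunc n); apply: eq_qmul => i ni.
  by rewrite euler_trunc_eq.
by rewrite npart_bounded_eq.
Qed.

(** The number of parts equal to j + 1 in all partitions of n. *)
Definition part_mult j : nat -> K := weight_sum (fun m => (m j)%:R).

(** Removing one part j + 1 from each partition that has one. *)
Lemma part_mult_rec j n :
  part_mult j n = qshift j.+1 (fun i => part_mult j i + npart i) n.
Proof.
have -> : part_mult j n =
    weight_sum (fun m => if m j == 0%N then 0 else (m j)%:R) n.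
  by apply: eq_bigr => m _; case: eqP => [->|].
rewrite weight_sum_shift /qshift; case: ifP => // _.
rewrite -big_split; apply: eq_bigr => m _.
by rewrite cmM cmUU add1n -natr1.
Qed.

(** By [part_mult_rec] and [euler_npart] the series y = euler * part_mult satisfies
y = q^(j+1) (y + 1), that is y = q^(j+1) / (1 - q^(j+1)). *)
Lemma euler_part_mult j n :
  qmul euler (part_mult j) n = ((0 < n) && (j.+1 %| n))%N%:R :> K.
Proof.
elim/ltn_ind: n => n IH.
rewrite (@eq_qmul _ euler _ (qshift j.+1 (fun i => part_mult j i + npart i))) //;
  last by move=> i _; exact: part_mult_rec.
rewrite qmul_shiftr /qshift; case: ltnP => [nj|jn].
  by case: n nj {IH} => [|n] nj //=; rewrite gtnNdvd.
have n0 : (0 < n)%N by exact: leq_trans jn.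
rewrite qmulDr euler_npart IH; last by rewrite ltn_subrL n0.
rewrite n0 subn_gt0 subn_eq0 dvdn_subl //.
have [->|nj] := eqVneq n j.+1; first by rewrite ltnn leqnn dvdnn add0r.
have jn' : (j.+1 < n)%N by rewrite ltn_neqAle eq_sym nj.
by rewrite jn' leqNgt jn' addr0.
Qed.

Lemma sigmaE (R : pzSemiRingType) r n : (0 < n)%N ->
  \sum_(j < n) j.+1%:R ^+ r * (j.+1 %| n)%N%:R = (sigma r n)%:R :> R.
Proof.
move=> n0; rewrite /sigma natr_sum.
have pe : perm_eq (divisors n) [seq d <- index_iota 1 n.+1 | (d %| n)%N].
  apply: uniq_perm; first exact: divisors_uniq.
    by rewrite filter_uniq ?iota_uniq.
  move=> d; rewrite mem_filter -dvdn_divisors // mem_index_iota ltnS.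
  by case dn: (d %| n)%N => //=; rewrite (dvdn_gt0 n0 dn) (dvdn_leq n0 dn).
rewrite (perm_big _ pe) big_filter [RHS]big_mkcond big_add1 /= big_mkord.
by apply: eq_bigr => j _; case: ifP => _; rewrite ?mulr1 ?mulr0 ?natrX.
Qed.

End PartitionSeries.

Section Rationals.

Variables (p : nat) (p_pr : prime p).
Local Notation K := (Qp p_pr).

Lemma ratr_Qp_int (z : int) : ratr z%:~R = z%:~R :> K.
Proof. by rewrite /ratr numq_int denq_int divr1. Qed.

Lemma intr_Qp_eq0 (z : int) : (z%:~R == 0 :> K) = (z == 0).
Proof.
by rewrite -padic_norm_eq0 -ratr_Qp_int padic_norm_ratr padic_abs_eq0 intr_eq0.
Qed.

(** [Qp] has characteristic 0 but carries no order, so the additive and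
multiplicative properties of [ratr] are derived from this formula. *)
Lemma ratr_Qp_frac (a b : int) : b != 0 -> ratr (a%:~R / b%:~R) = a%:~R / b%:~R :> K.
Proof.
move=> b0; set x : rat := _ / _.
have e : (numq x * b = a * denq x)%R.
  apply: (@intr_inj rat); rewrite !intrM.
  have := divq_num_den x; rewrite {3}/x => /eqP.
  by rewrite eqr_div ?intr_eq0 ?denq_neq0 // => /eqP.
apply/eqP; rewrite /ratr eqr_div ?intr_Qp_eq0 ?denq_neq0 //.
by rewrite -!intrM e.
Qed.

Lemma ratr_QpM x y : ratr (x * y) = ratr x * ratr y :> K.
Proof.
rewrite -{1}[x]divq_num_den -{1}[y]divq_num_den mulf_div -!intrM.
by rewrite ratr_Qp_frac ?mulf_neq0 ?denq_neq0 // !intrM -mulf_div.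
Qed.

Lemma ratr_QpB x y : ratr (x - y) = ratr x - ratr y :> K.
Proof.
have nz z : (denq z)%:~R != 0 :> K by rewrite intr_Qp_eq0 denq_neq0.
have nzq z : (denq z)%:~R != 0 :> rat by rewrite intr_eq0 denq_neq0.
have -> : x - y = (numq x * denq y - numq y * denq x)%:~R / (denq x * denq y)%:~R.
  rewrite -{1}[x]divq_num_den -{1}[y]divq_num_den rmorphB /= !intrM.
  by field; rewrite !nzq.
rewrite ratr_Qp_frac ?mulf_neq0 ?denq_neq0 // rmorphB /= !intrM /ratr mulrBl.
rewrite -mulf_div (mulfV (nz y)) mulr1; congr (_ - _).
by rewrite [_ * (denq x)%:~R]mulrC -mulf_div (mulfV (nz x)) mul1r.
Qed.

Lemma ratr_Qp_nat n : ratr n%:R = n%:R :> K.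
Proof. by have := ratr_Qp_int n; rewrite -!pmulrn. Qed.

Lemma natr_Qp_eq0 n : (n%:R == 0 :> K) = (n == 0%N).
Proof. by have := intr_Qp_eq0 n; rewrite -pmulrn. Qed.

End Rationals.

Section CharacterOfStates.

Variables (p : nat) (p_pr : prime p).
Local Notation K := (Qp p_pr).

Lemma graded_traceE (v : Fock p_pr) n :
  graded_trace v n = weight_sum (fun m => mcoeff m (zero_mode v (mono p_pr m))) n.
Proof. exact: fsbig_finite (finite_wt n). Qed.

Lemma graded_trace_state_u r n N : odd r -> (n <= N)%N ->
  graded_trace (state_u p_pr r) n = (1 - p%:R ^+ r) *
    (2 * \sum_(j < N) j.+1%:R ^+ r * part_mult p_pr j n
     - ratr (bernoulli r.+1 / r.+1%:R) * npart p_pr n).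
Proof.
move=> or nN; rewrite graded_traceE.
transitivity (weight_sum (fun m => (1 - p%:R ^+ r) *
   (2 * \sum_(j < N) j.+1%:R ^+ r * (m j)%:R
     - ratr (bernoulli r.+1 / r.+1%:R) * 1 : K)) n).
  apply: eq_weight_sum => m mn; rewrite (@zero_mode_state_u _ _ _ _ N) //.
    by rewrite mcoeffZ mcoeffUU !mulr1.
  by move=> j Nj; rewrite wt_coef0 // mn (leq_trans nN).
rewrite /weight_sum -mulr_sumr sumrB -!mulr_sumr exchange_big.
congr (_ * (_ * _ - _)); apply: eq_bigr => j _.
by rewrite mulr_sumr.
Qed.

(** Linearity reduces the product with the Euler function to [euler_npart] and
[euler_part_mult]; the sum of j^r over j dividing n is sigma_r(n). *)
Lemma character_state_u r n : odd r ->
  normalized_character (state_u p_pr r) n =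
  (1 - p%:R ^+ r) * (2 * eisensteinG p_pr r.+1 n).
Proof.
move=> or; rewrite /normalized_character.
rewrite (@eq_qmul _ _ _ (euler_prod p_pr) _ (fun i => (1 - p%:R ^+ r) *
    (2 * (\sum_(j <- index_enum 'I_n) j.+1%:R ^+ r * part_mult p_pr j i)
     - ratr (bernoulli r.+1 / r.+1%:R) * npart p_pr i))) //; last first.
  by move=> i ni; exact: graded_trace_state_u.
rewrite qmulZr; congr (_ * _).
rewrite qmulBr !qmulZr qmul_sumr euler_npart.
under eq_bigr do rewrite qmulZr euler_part_mult.
rewrite /eisensteinG; case: n => [|n] /=.
  rewrite big_ord0 mulr0 sub0r mulr1 mulrN -[2]ratr_Qp_nat -ratr_QpM -mul2n natrM.
  by congr (- ratr _); rewrite invfM [RHS]mulrCA mulVKf.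
by rewrite mulr0 subr0 sigmaE.
Qed.

End CharacterOfStates.

(** * The limit *)

Section Limit.

Variables (p : nat) (p_pr : prime p).
Hypothesis p_odd : odd p.
Local Notation K := (Qp p_pr).
Local Notation norm := (@padic_norm p p_pr).

Lemma norm_int (z : int) : norm z%:~R = padic_abs p_pr z%:~R.
Proof. by rewrite -ratr_Qp_int padic_norm_ratr. Qed.

Lemma norm1 : norm 1 = 1.
Proof. exact: etrans (norm_int 1) (padic_abs1 p_pr). Qed.

Lemma norm_int_le1 (z : int) : norm z%:~R <= 1.
Proof. by rewrite norm_int padic_abs_int. Qed.

Lemma norm_dvd (z : int) n :
  ((p ^ n)%N%:Z %| z)%Z -> norm z%:~R <= (p%:R ^+ n)^-1.
Proof. by rewrite norm_int; exact: padic_abs_dvd. Qed.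

Lemma norm_pX_weight a : norm (p%:R ^+ weight_seq p a) <= (p%:R ^+ a.+1)^-1.
Proof.
have := @norm_dvd (p ^ weight_seq p a)%N%:Z a.+1.
rewrite -pmulrn natrX; apply; rewrite /dvdz /=.
by apply: dvdn_exp2l; exact/ltnW/(ltn_weight_seq p_pr).
Qed.

Lemma norm_scale_le (x y : K) (d : rat) :
  norm x <= 1 -> norm y <= d -> norm (x * y) <= d.
Proof.
move=> x1; apply: le_trans.
by rewrite padic_normM ler_piMl ?padic_norm_ge0.
Qed.

(** Passage to the limit in an integer z(a) that is congruent to w modulo p^(a+1),
together with the factor 1 - p^r. *)
Lemma norm_stab_int a (z w : int) :
  ((p ^ a.+1)%N%:Z %| z - w)%Z ->
  norm ((1 - p%:R ^+ weight_seq p a) * z%:~R - w%:~R) <= (p%:R ^+ a.+1)^-1.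
Proof.
move=> /norm_dvd; rewrite rmorphB /= => zw.
rewrite mulrBl mul1r addrAC; apply: padic_norm_ultra => //.
rewrite padic_normN mulrC; apply: norm_scale_le (norm_int_le1 z) _.
exact: norm_pX_weight.
Qed.

Lemma ratr_stab r q : (1 - p%:R ^+ r) * ratr q = ratr ((1 - p%:R ^+ r) * q) :> K.
Proof.
rewrite [RHS]ratr_QpM ratr_QpB -!natrX ratr_Qp_nat.
by rewrite -[X in ratr X - _]/(1%:R) ratr_Qp_nat.
Qed.

Lemma ratr_QpN q : ratr (- q) = - ratr q :> K.
Proof. by rewrite -[- q]sub0r ratr_QpB -[0]/(0%:R) ratr_Qp_nat sub0r. Qed.

Lemma mon2_eqE k m : (mon2 k == m) = (k == (wt m).-2) && (mon2 (wt m).-2 == m).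
Proof.
apply/eqP/andP => [<-|[/eqP -> /eqP //]].
by rewrite wt_mon2 !eqxx.
Qed.

(** The family of coefficients c(k) at the monomials h_{-k-1} h_{-1}. Such a monomial
has weight k + 2, so its index can be read off from its weight. *)
Definition coef_index (c : nat -> K) (m : {cmonom nat}) : K :=
  if mon2 (wt m).-2 == m then c (wt m).-2 else 0.

(** As c(r, k) = 0 for k >= r, the truncation of the sum at r is invisible in the
coefficients. *)
Lemma coef_state_u r m : (0 < r)%N ->
  mcoeff m (state_u p_pr r) =
  (1 - p%:R ^+ r) * (coef_index (fun k => (coef_c r k)%:~R) m
    - ratr (bernoulli r.+1 / r.+1%:R) * (mone == m)%:R).
Proof.
move=> r0; rewrite /state_u mcoeffZ mcoeffB mcoeffZ; congr (_ * (_ - _)); last first.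
  by congr (_ * _); rewrite mcoeff1 eq_sym.
rewrite raddf_sum /=.
transitivity (\sum_(k < r) (coef_c r k)%:~R * (mon2 k == m)%:R : K).
  apply: eq_bigr => k _; rewrite mcoeffZ -(mcoeffU1 K).
  exact: (congr1 (fun v : Fock p_pr => _ * mcoeff m v) (heis_heis1 p_pr k)).
rewrite /coef_index; case: ifP => mm; last first.
  by apply: big1 => k _; rewrite mon2_eqE mm andbF mulr0.
have [wr|rw] := ltnP (wt m).-2 r.
  rewrite (bigD1 (Ordinal wr)) //= mon2_eqE eqxx mm mulr1 big1 ?addr0 // => k kn.
  rewrite mon2_eqE (_ : _ == _ = false) ?mulr0 //.
  by apply/negbTE; apply: contraNneq kn => kE; apply/eqP/val_inj.
rewrite big1 => [|k _].
  by case: r r0 rw => // r _ rw; rewrite coef_c_eq0.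
rewrite mon2_eqE (_ : _ == _ = false) ?mulr0 //.
by apply/negbTE; rewrite ltn_eqF // (leq_trans (ltn_ord k)).
Qed.

Lemma subr_subr_interchange (V : zmodType) (x y z t : V) :
  x - y - (z - t) = x - z - (y - t).
Proof. by rewrite [in LHS]opprD [LHS]addrACA [in RHS]opprD. Qed.

Definition u_lim_coef (m : {cmonom nat}) : K^o :=
  coef_index (fun k => (coef_c_lim p k)%:~R) m
  - ratr ((1 - p%:R) / 12) * (mone == m)%:R.

(** Uniform over all monomials: the congruence for c(r, m) is uniform in m. *)
Lemma state_u_near (e : rat) : 0 < e -> exists A, forall a, (A <= a)%N ->
  forall m, norm (mcoeff m (state_u p_pr (weight_seq p a)) - u_lim_coef m) < e.
Proof.
move=> e0; have [A hA] := bernoulli_stab_cvg p_pr p_odd e0.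
have [A' hA'] := eventually_pX_lt p_pr e0.
exists (maxn A A') => a; rewrite geq_max => /andP[/hA {}hA /hA' {}hA'] m.
rewrite coef_state_u // mulrBr mulrA ratr_stab /u_lim_coef.
rewrite [X in norm X]subr_subr_interchange -mulrBl -ratr_QpB.
apply: padic_norm_ultra_lt.
  apply: le_lt_trans hA'; rewrite /coef_index; case: ifP => _.
    by apply: norm_stab_int; exact: coef_c_lim_dvd.
  by rewrite mulr0 subrr padic_norm0 invr_ge0 exprn_ge0.
rewrite padic_normN padic_normM padic_norm_ratr; apply: le_lt_trans hA.
case: (mone == m); last by rewrite padic_norm0 mulr0 padic_abs_ge0.
by rewrite norm1 mulr1.
Qed.

(** A uniform limit of finitely supported families tends to zero. *)
Lemma u_lim_S1 : u_lim_coef \in @S1_pred p p_pr.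
Proof.
apply/asboolP => e e0; have [A hA] := state_u_near e0.
have /asboolP/(_ e e0) := valP (S1_of (state_u p_pr (weight_seq p A))).
apply: sub_finite_set => m /= em; rewrite leNgt; apply/negP => lt_e.
move: em; rewrite leNgt => /negP; apply.
have -> : u_lim_coef m = mcoeff m (state_u p_pr (weight_seq p A))
    - (mcoeff m (state_u p_pr (weight_seq p A)) - u_lim_coef m).
  by rewrite [RHS]subKr.
by apply: padic_norm_ultra_lt => //; rewrite padic_normN hA.
Qed.

Definition u_lim : S1 p_pr := MkS1 u_lim_S1.

Lemma ball_S1P (x y : S1 p_pr) (e : rat) :
  ball x e y <-> forall m, norm (x m - y m) < e.
Proof. by []. Qed.

Lemma ball_MpP (x y : Mp p_pr) (e : rat) :
  ball x e y <-> forall n, norm ((x : qser p_pr) n - (y : qser p_pr) n) < e.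
Proof. by []. Qed.

Lemma state_u_cvg :
  (fun a => S1_of (state_u p_pr (weight_seq p a))) @ \oo --> u_lim.
Proof.
apply/cvg_ballP => e e0; have [A hA] := state_u_near e0.
exists A => // a Aa; apply/ball_S1P => m.
by rewrite -padic_normN opprB; exact: hA.
Qed.

Lemma sigma_stab_dvd a n :
  ((p ^ a.+1)%N%:Z %| (sigma (weight_seq p a) n)%:Z
     - (\sum_(d <- divisors n | coprime d p) d)%N%:Z)%Z.
Proof.
rewrite /sigma [X in _ - (X%:Z)]big_mkcond -!(@natz _) !natr_sum -sumrB natz.
apply: (big_ind (fun z => (p ^ a.+1)%N%:Z %| z)%Z) => [|x y|d _].
- exact: dvdz0.
- exact: rpredD.
have -> : weight_seq p a = (weight_seq p a).-1.+1 by rewrite /weight_seq add1n.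
have -> : (d ^ (weight_seq p a).-1.+1)%:R - (if coprime d p then d else 0%N)%:R =
    d%:Z * ((d ^ (weight_seq p a).-1)%N%:Z - (coprime d p)%:Z).
  rewrite expnS !natz PoszM mulrBr; congr (_ - _).
  by case: coprime; rewrite ?mulr1 ?mulr0.
by apply: dvdz_mull; exact: expn_weight_seq.
Qed.

Lemma character_near (e : rat) n : 0 < e -> exists A, forall a, (A <= a)%N ->
  norm (normalized_character (state_u p_pr (weight_seq p a)) n
    - 2 * eisensteinG2_stab p_pr n) < e.
Proof.
move=> e0; have [A hA] := bernoulli_stab_cvg p_pr p_odd e0.
have [A' hA'] := eventually_pX_lt p_pr e0.
exists (maxn A A') => a; rewrite geq_max => /andP[/hA {}hA /hA' {}hA'].
rewrite character_state_u; last first.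
  by rewrite /weight_seq oddD oddM oddB ?prime_gt0 // p_odd andbF.
rewrite mulrCA -mulrBr padic_normM -[2]ratr_Qp_nat padic_norm_ratr.
rewrite padic_abs2 // mul1r /eisensteinG /eisensteinG2_stab.
case: n => [|n] /=.
  rewrite mulrN -opprD padic_normN ratr_stab.
  have -> : p.-1%:R / 24 = - ((1 - p%:R) / 24) :> rat.
    by rewrite -subn1 natrB ?prime_gt0 // -mulNr opprB.
  rewrite ratr_QpN -ratr_QpB padic_norm_ratr; apply: le_lt_trans hA.
  set b := bernoulli _; set k := (weight_seq p a).+1.
  set x := (1 - p%:R ^+ _).
  have -> : x * (b / k%:R) - (1 - p%:R) / 12 =
      2 * (x * (b / k.*2%:R) - (1 - p%:R) / 24).
    by rewrite -mul2n natrM; field; rewrite pnatr_eq0.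
  by rewrite padic_absM padic_abs2 // mul1r.
apply: le_lt_trans hA'; rewrite [X in norm X](_ : _ =
  (1 - p%:R ^+ weight_seq p a) * (sigma (weight_seq p a) n.+1)%:Z%:~R
  - (\sum_(d <- divisors n.+1 | coprime d p) d)%N%:Z%:~R) //.
by apply: norm_stab_int; exact: sigma_stab_dvd.
Qed.

End Limit.

Theorem mainTheorem5 (p : nat) (p_pr : prime p) (p_odd : odd p)
    (f : {linear S1 p_pr -> Mp p_pr}) (f_char : is_character_map f) :
  let r (a : nat) := (1 + p ^ a * (p - 1))%N in
  exists (u1' : S1 p_pr) (g : nat -> Mp p_pr) (G2s : Mp p_pr),
    [/\ (fun a => S1_of (state_u p_pr (r a))) @ \oo --> u1',
        forall a, g a = (1 - p%:R ^+ r a) *: (2 *: eisensteinG p_pr (r a).+1)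
                  :> qser p_pr,
        g @ \oo --> f u1',
        G2s = eisensteinG2_stab p_pr :> qser p_pr
      & f u1' = 2 *: G2s]
    /\ exists x : S1 p_pr, f x = G2s.
Proof.
move=> r; case: f_char => f_cont f_val.
pose u1' := u_lim p_pr p_odd.
pose g a := f (S1_of (state_u p_pr (r a))).
have cvg_u : (fun a => S1_of (state_u p_pr (r a))) @ \oo --> u1'.
  exact: state_u_cvg.
have cvg_g : g @ \oo --> f u1'.
  exact: (continuous_cvg _ (f_cont u1') cvg_u).
have odd_r a : odd (r a).
  by rewrite /r oddD oddM oddB ?prime_gt0 // p_odd andbF.
have two0 : (2 : Qp p_pr) != 0 by rewrite natr_Qp_eq0.
have f_lim n : (f u1' : qser p_pr) n = 2 * eisensteinG2_stab p_pr n.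
  apply/eqP; rewrite -subr_eq0 -padic_norm_eq0; apply/eqP.
  have := padic_norm_ge0 ((f u1' : qser p_pr) n - 2 * eisensteinG2_stab p_pr n).
  rewrite le_eqVlt => /predU1P[//|e0]; exfalso.
  have [A hA] := character_near p_pr p_odd n e0.
  have /cvg_ballP/(_ _ e0)[B _ hB] := cvg_g.
  have := hB (maxn A B) (leq_maxr _ _) => /ball_MpP/(_ n).
  have := hA (maxn A B) (leq_maxl _ _).
  rewrite -f_val => h1 h2; have := padic_norm_ultra_lt h2 h1.
  by rewrite subrKA ltxx.
exists u1', g, (2^-1 *: f u1'); split; last first.
  by exists (2^-1 *: u1'); rewrite linearZ.
split=> //.
- move=> a; rewrite /g f_val; apply/funext => n; exact: character_state_u.
- apply/funext => n.
  transitivity (2^-1 * (f u1' : qser p_pr) n) => //.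
  by rewrite f_lim mulKf.
- by rewrite scalerA mulfV ?scale1r.
Qed.
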